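(* Fix $c>0$ and an integer $K\ge1$, and let $p_n=c/n$. For the Threshold exploration algorithm on $n$ vertices (described in the context) let $A_k(t)=|\mathcal{A}_k(t)|$ and define $\alpha^n_k(t)=A_k(\lfloor nt\rfloor)/n$ for $t\in[0,1]$, $0\le k\le K-1$, and $\boldsymbol{\alpha}^n(t)=(\alpha^n_0(t),\dots,\alpha^n_{K-1}(t))$. For $\boldsymbol{\alpha}=(\alpha_0,\dots,\alpha_{K-1})$ write $\alpha_{\le k}=\alpha_0+\dots+\alpha_k$ and $S(\boldsymbol\alpha)=\sum_{r=0}^{K-2}c^r\alpha_{\le K-2}^r/r!$, and define $$\delta_0(\boldsymbol\alpha)=-c\alpha_0e^{-c\alpha_{\le K-1}}S(\boldsymbol\alpha)+e^{-c\alpha_{\le K-1}},$$ $$\delta_k(\boldsymbol\alpha)=c(\alpha_{k-1}-\alpha_k)e^{-c\alpha_{\le K-1}}S(\boldsymbol\alpha)+e^{-c\alpha_{\le K-1}}\frac{c^k\alpha_{\le K-2}^k}{k!},\quad 1\le k\le K-2,$$ $$\delta_{K-1}(\boldsymbol\alpha)=c\alpha_{K-2}e^{-c\alpha_{\le K-1}}S(\boldsymbol\alpha)+e^{-c\alpha_{\le K-1}}\frac{c^{K-1}\alpha_{\le K-2}^{K-1}}{(K-1)!}.$$ Then the integral equations $\alpha_k(t)=\int_0^t\delta_k(\boldsymbol\alpha(s))\,ds$, $0\le k\le K-1$, $t\in[0,1]$, have a unique solution $\boldsymbol\alpha(t)=(\alpha_0(t),\dots,\alpha_{K-1}(t))$,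 and the process $\{\boldsymbol\alpha^n(t)\}_{0\le t\le1}$ converges in distribution (uniformly on $[0,1]$) to the deterministic process $\{\boldsymbol\alpha(t)\}_{0\le t\le1}$. Consequently, if $\mathcal{I}(n)$ is the final active set of the Threshold model on $G(n,c/n)$ and $I(n)=|\mathcal{I}(n)|$, then $I(n)/n\to\sum_{k=0}^{K-1}\alpha_k(1)$ in distribution as $n\to\infty$.
   Context: Empty sums are zero and empty products are one (so for $K=1$, $S\equiv0$, $\alpha_{\le K-2}=0$ and only $\delta_0=e^{-c\alpha_0}$ is present; any term with index $-1$ is zero). $G(n,p_n)$ is the Erdős–Rényi random graph on $[n]$ with independent edge probability $p_n$. Threshold model: given $G(n,p_n)$, set $\mathcal{I}(0)=\varnothing$; at each step $t+1$ a vertex $v$ is chosen uniformly at random among vertices not yet selected, and $\mathcal{I}(t+1)=\mathcal{I}(t)\cup\{v\}$ if the subgraph induced by $\mathcal{I}(t)\cup\{v\}$ has maximum degree $<K$, else $\mathcal{I}(t+1)=\mathcal{I}(t)$. Threshold exploration algorithm: maintain $\mathcal{A}_0(t),\dots,\mathcal{A}_{K-1}(t)$, $\mathcal{B}(t)$, $\mathcal{U}(t)$, initially $\mathcal{A}_k(0)=\mathcal{B}(0)=\varnothing$, $\mathcal{U}(0)=[n]$; $\mathcal{A}(t)=\bigcup_k\mathcal{A}_k(t)$. At step $t+1$, select $v\in\mathcal{U}(t)$ uniformly, remove it from $\mathcal{U}$, and join it to each $u\in\mathcal{A}(t)\cup\mathcal{B}(t)$ independently with probability $p_n$. Let $v_1,\dots,v_r$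 be the vertices of $\mathcal{A}(t)$ joined to $v$, $v_i\in\mathcal{A}_{k_i}(t)$. If $r<K$ and no $v_i\in\mathcal{A}_{K-1}(t)$, put $v$ into $\mathcal{A}_r$ and move each $v_i$ from $\mathcal{A}_{k_i}$ to $\mathcal{A}_{k_i+1}$; otherwise put $v$ into $\mathcal{B}$. Convergence in distribution of processes is understood as uniform convergence over compact sets. *)

(* Defs.v *)
From HB Require Import structures.
From mathcomp Require Import all_boot all_order all_algebra all_fingroup.
From mathcomp Require Import all_classical all_reals all_analysis.
Set Implicit Arguments. Unset Strict Implicit. Unset Printing Implicit Defensive.
Import Order.TTheory GRing.Theory Num.Theory numFieldNormedType.Exports.
Local Open Scope classical_set_scope.
Local Open Scope ring_scope.

Section Defs.
Variable R : realType.

Section Delta.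
Variables (K : nat) (c : R) (a : 'I_K -> R).

Definition aget (j : nat) : R :=
  match @insub nat (fun j => j < K)%N _ j with Some i => a i | None => 0 end.

Definition asum_lt (m : nat) : R := \sum_(j < m) aget j.

(* alpha_{<= K-2} (= 0 when K = 1) and alpha_{<= K-1} *)
Definition aK2 : R := asum_lt K.-1.
Definition aK1 : R := asum_lt K.

Definition Sfun : R := \sum_(r < K.-1) c ^+ r * aK2 ^+ r / (r`!)%:R.

Definition Efac : R := expR (- (c * aK1)).

Definition delta (k : nat) : R :=
  if k == 0%N then - (c * aget 0) * Efac * Sfun + Efac
  else if k == K.-1 then
    c * aget K.-2 * Efac * Sfun + Efac * (c ^+ K.-1 * aK2 ^+ K.-1 / ((K.-1)`!)%:R)
  else c * (aget k.-1 - aget k) * Efac * Sfun + Efac * (c ^+ k * aK2 ^+ k / (k`!)%:R).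
End Delta.

Definition is_solution (K : nat) (c : R) (f : R -> 'I_K -> R) : Prop :=
  forall (k : 'I_K) (t : R), 0 <= t <= 1 ->
    (lebesgue_measure).-integrable `[0, t] (fun s => (delta c (f s) k)%:E) /\
    f t k = Rintegral lebesgue_measure `[0, t] (fun s => delta c (f s) k).

(* A sample is (sigma, E): sigma the order in which vertices are selected
   (vertex selected at step t+1 is sigma t), E the edge set, encoded as
   pairs (i,j) with i < j. *)
Definition upper_pairs (n : nat) : {set 'I_n * 'I_n} :=
  [set e : 'I_n * 'I_n | (e.1 < e.2)%N].

Definition weight (n : nat) (p : R) (s : 'S_n) (E : {set 'I_n * 'I_n}) : R :=
  if E \subset upper_pairs n then
    (n`!)%:R^-1 * (p ^+ #|E| * (1 - p) ^+ (#|upper_pairs n| - #|E|))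
  else 0.

Definition Exp (n : nat) (p : R) (X : 'S_n -> {set 'I_n * 'I_n} -> R) : R :=
  \sum_(s : 'S_n) \sum_(E : {set 'I_n * 'I_n}) weight p s E * X s E.

Definition adj (n : nat) (E : {set 'I_n * 'I_n}) (u v : 'I_n) : bool :=
  (u != v) && (((u, v) \in E) || ((v, u) \in E)).

Inductive vstat := Unexpl | InA of nat | InB.

Definition inA (k : nat) (x : vstat) : bool :=
  if x is InA j then j == k else false.
Definition inAany (x : vstat) : bool := if x is InA _ then true else false.
Definition lvl (x : vstat) : nat := if x is InA j then j else 0%N.

Section Explore.
Variables (K n : nat) (s : 'S_n) (E : {set 'I_n * 'I_n}).

Definition explore_step (t : nat) (st : 'I_n -> vstat) : 'I_n -> vstat :=
  match @insub nat (fun j => j < n)%N _ t with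
  | None => st
  | Some i =>
    let v := s i in
    let nb := [set u | inAany (st u) && adj E u v] in
    let r := #|nb| in
    if (r < K)%N && [forall u in nb, lvl (st u) != K.-1] then
      fun u => if u == v then InA r
               else if u \in nb then InA (lvl (st u)).+1 else st u
    else fun u => if u == v then InB else st u
  end.

Fixpoint explore (m : nat) : 'I_n -> vstat :=
  match m with
  | 0 => fun _ => Unexpl
  | m'.+1 => explore_step m' (explore m')
  end.

Definition Acount (k m : nat) : nat := #|[set u | inA k (explore m u)]|.
End Explore.

Definition alpha_n (K n : nat) (s : 'S_n) (E : {set 'I_n * 'I_n})
    (t : R) (k : 'I_K) : R :=
  (Acount K s E k (Num.truncn (n%:R * t)))%:R / n%:R.

Section Threshold.
Variables (K n : nat) (s : 'S_n) (E : {set 'I_n * 'I_n}).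

Definition maxdeg_lt (S : {set 'I_n}) : bool :=
  [forall u in S, #|[set w in S | adj E u w]| < K]%N.

Fixpoint threshold (m : nat) : {set 'I_n} :=
  match m with
  | 0 => @finset.set0 _
  | m'.+1 =>
    let I := threshold m' in
    match @insub nat (fun j => j < n)%N _ m' with
    | None => I
    | Some i => if maxdeg_lt (s i |: I) then s i |: I else I
    end
  end.

Definition final_active : {set 'I_n} := threshold n.
End Threshold.

Definition unif_close (K : nat) (g h : R -> 'I_K -> R) (d : R) : Prop :=
  forall t, 0 <= t <= 1 -> forall k, `|h t k - g t k| <= d.

Definition unif_continuous_at (K : nat) (F : (R -> 'I_K -> R) -> R)
    (g : R -> 'I_K -> R) : Prop :=
  forall e : R, 0 < e -> exists2 d : R, 0 < d &
    forall h, unif_close g h d -> `|F h - F g| < e.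

Definition path_functional_ok (K : nat) (F : (R -> 'I_K -> R) -> R) : Prop :=
  (exists M : R, forall g, `|F g| <= M) /\ (forall g, unif_continuous_at F g).

Definition conv_dist_path (K : nat) (p : nat -> R)
    (X : forall n, 'S_n -> {set 'I_n * 'I_n} -> R -> 'I_K -> R)
    (a : R -> 'I_K -> R) : Prop :=
  forall F, path_functional_ok F ->
    (fun n => Exp (p n) (fun s E => F (X n s E))) @ \oo --> F a.

Definition conv_dist_real (p : nat -> R)
    (Y : forall n, 'S_n -> {set 'I_n * 'I_n} -> R) (L : R) : Prop :=
  forall g : R -> R, (exists M : R, forall x, `|g x| <= M) -> continuous g ->
    (fun n => Exp (p n) (fun s E => g (Y n s E))) @ \oo --> g L.

End Defs.

(* Main.v *)
Require Import Defs.
From HB Require Import structures.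
From mathcomp Require Import all_boot all_order all_algebra all_fingroup.
From mathcomp Require Import all_classical all_reals all_analysis.
From mathcomp Require Import ring lra zify.
Set Implicit Arguments. Unset Strict Implicit. Unset Printing Implicit Defensive.
Import Order.TTheory GRing.Theory Num.Theory numFieldNormedType.Exports.
Local Open Scope ring_scope.

(** Given the statuses after t steps, the edges from the next vertex to the
    active ones are fresh, so its active neighbourhood is a random subset of the
    active set with independent inclusions of probability c/n. The Poisson
    approximation of the binomial weights shows that the expected increment of
    A_k is delta_k(A/n) up to O(1/n). If a solves the integral equations, the
    mean of D_t = sum_k (A_k(t)/n - a_k(t/n))^2 therefore satisfies
    E D_(t+1) <= (1 + O(1/n)) E D_t + O(1/n^2), hence E D_t = O(1/n) for t <= n.
    As A_k/n and a_k are Lipschitz, closeness at a bounded number of times gives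
    uniform closeness, and Chebyshev's inequality concludes.

    For the existence of a, the arguments of delta are first clamped to [0,1],
    which makes delta bounded and globally Lipschitz, so that Picard iteration
    applies. The clamping does not affect the second moment estimate, because
    A_k/n lies in [0,1]; and this estimate forces a to stay in [0,1], so that a
    solves the original equations.

    The active set of the threshold model is the set of active vertices of the
    exploration, because the level of an active vertex is its degree in the
    active set. *)

(** * The integral equations *)

Section Integral.
Local Open Scope classical_set_scope.
Variable R : realType.
Notation mu := (@lebesgue_measure R).
Implicit Types (f : R -> R) (s t : R).

Lemma continuous_integrable_itv f (b1 b2 : bool) s t : continuous f ->
  mu.-integrable [set` Interval (BSide b1 s) (BSide b2 t)] (EFin \o f).
Proof.
move=> cf; apply: (@integrableS _ _ _ mu `[s, t]) => //.
  by apply: subset_itv; rewrite ?bnd_simp; case: b1 => //; case: b2.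
apply: continuous_compact_integrable; first exact: segment_compact.
exact: continuous_subspaceT.
Qed.

(** With [v] = 0 this yields the Lipschitz bound of an integral, and with [v] the integrand at the
    left endpoint it yields the error of one Euler step. *)
Lemma Rintegral_increment f s t v e : 0 <= s -> s <= t ->
  mu.-integrable `[0, t] (EFin \o f) ->
  (forall x, s <= x <= t -> `|f x - v| <= e) ->
  `|Rintegral mu `[0, t] f - Rintegral mu `[0, s] f - v * (t - s)|
     <= e * (t - s).
Proof.
move=> s0 st fi fv.
have -> : Rintegral mu `[0, t] f - Rintegral mu `[0, s] f
          = Rintegral mu `]s, t] f.
  by apply: (@Rintegral_itvB _ _ (BLeft 0) (BRight t)) => //; rewrite bnd_simp.
have fi' : mu.-integrable `]s, t] (EFin \o f).
  by apply: integrableS fi => //; apply: subset_itvr; rewrite bnd_simp.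
have ci (w : R) : mu.-integrable `]s, t] (EFin \o cst w).
  by apply: continuous_integrable_itv; exact: cst_continuous.
have mst : fine (mu `]s, t]) = t - s.
  rewrite lebesgue_measure_itv /= lte_fin; case: ltP => // ts.
  by have -> : s = t by [apply/eqP; rewrite eq_le st ts]; rewrite subrr.
have csti w : Rintegral mu `]s, t] (fun=> w) = w * (t - s).
  by rewrite Rintegral_cst// mst.
rewrite -(csti v) -(csti e) -RintegralB//; last exact: ci.
have bi : mu.-integrable `]s, t] (EFin \o (fun x => f x - v)).
  have -> : EFin \o (fun x => f x - v) = ((EFin \o f) \- (EFin \o cst v))%E.
    by apply/funext => x /=; rewrite EFinB.
  by apply: integrableB => //; exact: ci.
apply: le_trans (le_normr_Rintegral _ bi) _ => //.
apply: le_Rintegral => //.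
- exact: (integrable_norm bi).
- exact: ci.
- by move=> x /=; rewrite in_itv /= => /andP[sx xt]; rewrite fv// (ltW sx).
Qed.

Lemma Rintegral_expR (l t : R) : 0 < l -> 0 <= t ->
  Rintegral mu `[0, t] (fun x => expR (l * x)) = (expR (l * t) - 1) / l.
Proof.
move=> l0; rewrite le_eqVlt => /predU1P[<-|t0].
  by rewrite set_itv1 Rintegral_set1 mulr0 expR0 subrr mul0r.
pose F x := expR (l * x) / l.
have dF (x : R) : is_derive x (1 : R) F (expR (l * x)).
  have : is_derive x (1 : R) (fun x => l^-1 * expR (l * x)) (l^-1 * (expR (l * x) * l)).
    apply: is_deriveZ.
    apply: is_derive1_comp.
    rewrite -[X in is_derive _ _ _ X]mulr1.
    by apply: (@is_deriveZ _ _ _ id l).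
  rewrite (_ : (fun _ => _) = F); last by apply/funext => y; rewrite /F mulrC.
  by rewrite mulrCA mulVf ?mulr1// gt_eqF.
have cF : continuous F.
  by move=> x; apply: differentiable_continuous; apply/derivable1_diffP; case: (dF x).
have ce : continuous (fun x : R => expR (l * x)).
  move=> x; apply: continuous_comp; last exact: continuous_expR.
  by apply: continuousM; [exact: cst_continuous|exact: cvg_id].
rewrite /Rintegral (@continuous_FTC2 _ (fun x => expR (l * x)) F 0 t)//=.
- by rewrite /F mulr0 expR0 mulrBl mul1r.
- exact: continuous_subspaceT.
- split.
  + by move=> x _; case: (dF x).
  + exact/cvg_at_right_filter/cF.
  + exact/cvg_at_left_filter/cF.
- by move=> x _; rewrite derive1E; case: (dF x).
Qed.

(** Integration from 0 reproduces the weight e^(l x) up to a factor 1/l, so a large l makes the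
    integral operator contract on an interval of any length. *)
Lemma Rintegral_le_expR f (l t M : R) : 0 < l -> 0 <= t -> 0 <= M ->
  mu.-integrable `[0, t] (EFin \o f) ->
  (forall x, 0 <= x <= t -> `|f x| <= M * expR (l * x)) ->
  `|Rintegral mu `[0, t] f| <= M / l * expR (l * t).
Proof.
move=> l0 t0 M0 fi fM; apply: le_trans (le_normr_Rintegral _ fi) _ => //.
have ce : continuous (fun x : R => expR (l * x)).
  move=> x; apply: continuous_comp; last exact: continuous_expR.
  by apply: continuousM; [exact: cst_continuous|exact: cvg_id].
apply: (@le_trans _ _ (Rintegral mu `[0, t] (fun x => M * expR (l * x)))).
  apply: le_Rintegral => //.
  - exact: (integrable_norm fi).
  - apply: continuous_integrable_itv => x.
    by apply: (@continuousM _ _ (cst M) (fun x => expR (l * x))); [exact: cst_continuous|exact: ce].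
rewrite RintegralZl//; last exact: continuous_integrable_itv.
rewrite Rintegral_expR// -mulrA ler_wpM2l// mulrC ler_wpM2l ?invr_ge0 1?ltW//.
by rewrite gtrBl ltr01.
Qed.

End Integral.

Section RealSequences.
Local Open Scope classical_set_scope.
Variable R : realType.

Lemma le0_geometric (x C : R) : (forall m, x <= C / 2 ^+ m) -> x <= 0.
Proof.
move=> xC; rewrite leNgt; apply/negP => x0.
have := xC (Num.bound `|C / x|).
rewrite ler_pdivlMr ?exprn_gt0// => /(_ : _ -> False); apply.
apply/negP; rewrite -ltNge -ltr_pdivrMl// mulrC.
apply: le_lt_trans (ler_norm _) _; apply: lt_le_trans (archi_boundP _) _ => //.
by rewrite -natrX ler_nat ltnW// ltn_expl.
Qed.

(** The intervals [u m - e m, u m + e m] meet pairwise, so the supremum of their left endpoints lies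
    in all of them. *)
Lemma cauchy_rate (u e : nat -> R) :
  (forall m j, `|u m - u j| <= e m + e j) ->
  exists a, forall m, `|a - u m| <= e m.
Proof.
move=> ue; pose A := [set u m - e m | m in [set: nat]].
have Aub j : ubound A (u j + e j).
  move=> _ [m _ <-]; have := ue m j; rewrite ler_norml => /andP[_].
  by rewrite lerBlDr lerBlDr => h; rewrite (le_trans h)//; lra.
have A0 : A !=set0 by exists (u 0 - e 0); exists 0.
have Asup : has_sup A by split => //; exists (u 0 + e 0); exact: Aub.
exists (sup A) => m; rewrite ler_distl; apply/andP; split.
- by apply: ub_le_sup; [case: Asup | exists m].
- by apply: ge_sup => //; exact: Aub.
Qed.

End RealSequences.

(** * Picard iteration in an exponentially weighted norm *)

Section Picard.
Local Open Scope classical_set_scope.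
Variables (R : realType) (K : nat).
Notation mu := (@lebesgue_measure R).
Implicit Types (x y : 'I_K -> R) (a b u : R -> 'I_K -> R).

Definition dist1 x y : R := \sum_i `|x i - y i|.

Lemma dist1_ge0 x y : 0 <= dist1 x y.
Proof. by apply: sumr_ge0. Qed.

Lemma dist1C x y : dist1 x y = dist1 y x.
Proof. by apply: eq_bigr => i _; rewrite distrC. Qed.

Lemma ler_dist1 x y i : `|x i - y i| <= dist1 x y.
Proof. by rewrite /dist1 (bigD1 i)//= lerDl sumr_ge0. Qed.

Lemma dist1_le_const x y (M : R) : (forall i, `|x i - y i| <= M) ->
  dist1 x y <= K%:R * M.
Proof.
move=> xyM; apply: (@le_trans _ _ (\sum_(i < K) M)); first exact: ler_sum.
by rewrite sumr_const card_ord mulr_natl.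
Qed.

Lemma dist1_eq0 x y : dist1 x y <= 0 -> x = y.
Proof.
move=> xy; apply/funext => i; apply/eqP; rewrite -subr_eq0 -normr_le0.
exact: le_trans (ler_dist1 x y i) xy.
Qed.

Variables (f : ('I_K -> R) -> 'I_K -> R) (B L : R).

(* In the norm [sup_t e^(-l t) |u t|_1] the integral operator contracts by 1/2. *)
Lemma integral_contraction (S : ('I_K -> R) -> Prop) a b (W l t : R) :
  0 < L -> 0 <= W -> l = 2 * K.+1%:R * L -> 0 <= t ->
  (forall x y k, S x -> S y -> `|f x k - f y k| <= L * dist1 x y) ->
  (forall s, 0 <= s <= t -> S (a s) /\ S (b s)) ->
  (forall k, mu.-integrable `[0, t] (EFin \o (fun s => f (a s) k))) ->
  (forall k, mu.-integrable `[0, t] (EFin \o (fun s => f (b s) k))) ->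
  (forall s, 0 <= s <= t -> dist1 (a s) (b s) <= W * expR (l * s)) ->
  dist1 (fun k => Rintegral mu `[0, t] (fun s => f (a s) k))
        (fun k => Rintegral mu `[0, t] (fun s => f (b s) k))
    <= W / 2 * expR (l * t).
Proof.
move=> L0 W0 lE t0 fL Sab ai bi abW.
have l0 : 0 < l by rewrite lE !mulr_gt0// ltr0n.
(* Each of the K coordinates contributes at most L W e^(l t) / l, and K L / l = K / (2 (K + 1)) <=
   1/2; the successor keeps l positive for K = 0. *)
apply: le_trans (@dist1_le_const _ _ (L * W / l * expR (l * t)) _) _.
  move=> k; rewrite -RintegralB//.
  apply: Rintegral_le_expR => //; first by rewrite mulr_ge0// ltW.
    have -> : EFin \o (fun s => f (a s) k - f (b s) k) =
      ((EFin \o (fun s => f (a s) k)) \- (EFin \o (fun s => f (b s) k)))%E.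
      by apply/funext => s /=; rewrite EFinB.
    exact: integrableB.
  move=> s st; have [Sa Sb] := Sab s st.
  by apply: le_trans (fL _ _ _ Sa Sb) _; rewrite -mulrA ler_pM2l// abW.
rewrite mulrA ler_wpM2r ?expR_ge0// lE.
have K0 : K.+1%:R != 0 :> R by rewrite pnatr_eq0.
have -> : K%:R * (L * W / (2 * K.+1%:R * L)) = W / 2 * (K%:R / K.+1%:R) :> R.
  have := lt0r_neq0 L0; move: (K%:R) => k'; move: K0; move: (K.+1%:R) => k''.
  by move=> k0 l1; field; rewrite k0 l1.
rewrite ler_piMr ?divr_ge0// ler_pdivrMr ?ltr0n// mul1r ler_nat //.
Qed.

Hypothesis L0 : 0 < L.
Hypothesis fB : forall x k, `|f x k| <= B.
Hypothesis fL : forall x y k, `|f x k - f y k| <= L * dist1 x y.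

Definition path_lipschitz u := forall s t k, `|u s k - u t k| <= B * `|s - t|.

Lemma bound_ge0 : 'I_K -> 0 <= B.
Proof. by move=> k; exact: le_trans (fB (fun=> 0) k). Qed.

Lemma field_path_continuous u k : path_lipschitz u ->
  continuous (fun s => f (u s) k).
Proof.
move=> ulip s; apply/cvgrPdist_le => /= e e0.
have C0 : 0 < L * (K%:R * (B + 1)).
  rewrite !mulr_gt0// ?ltr0n; first exact: leq_ltn_trans (ltn_ord k).
  by rewrite ltr_wpDl// (bound_ge0 k).
near=> t.
apply: le_trans (fL _ _ _) _.
have : dist1 (u s) (u t) <= K%:R * ((B + 1) * `|s - t|).
  apply: dist1_le_const => i; apply: le_trans (ulip _ _ _) _.
  by rewrite ler_wpM2r// lerDl.
rewrite -(ler_pM2l L0) => /le_trans; apply.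
rewrite !mulrA -!(mulrA L) mulrC -ler_pdivlMr ?gt_eqF//.
near: t; exists (e / (L * (K%:R * (B + 1)))) => /=; first by rewrite divr_gt0.
move=> t; rewrite /ball_ /= => /ltW; rewrite (ler_pdivlMr _ _ C0) => h.
by rewrite ler_pdivlMr// mulrC mulrA mulrC.
Unshelve. all: by end_near. Qed.

Lemma field_path_integrable u k t : path_lipschitz u ->
  mu.-integrable `[0, t] (EFin \o (fun s => f (u s) k)).
Proof.
by move=> ulip; apply: continuous_integrable_itv; exact: field_path_continuous.
Qed.

Definition picard u : R -> 'I_K -> R :=
  fun t k => Rintegral mu `[0, t] (fun s => f (u s) k).

(** The integral over an empty interval vanishes, so the iterates are zero on the negative axis and
    can be treated as Lipschitz paths on the whole line. *)
Lemma picard_neg u t k : t < 0 -> picard u t k = 0.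
Proof. by move=> t0; rewrite /picard set_itv_ge ?bnd_simp -?ltNge// Rintegral_set0. Qed.

Lemma picard_0 u k : picard u 0 k = 0.
Proof. by rewrite /picard set_itv1 Rintegral_set1. Qed.

Lemma picard_lipschitz u : path_lipschitz u -> path_lipschitz (picard u).
Proof.
move=> ulip.
have pos s t k : 0 <= s -> s <= t ->
    `|picard u t k - picard u s k| <= B * (t - s).
  move=> s0 st; have := @Rintegral_increment _ (fun s => f (u s) k) s t 0 B s0 st.
  rewrite mul0r subr0; apply; first exact: field_path_integrable.
  by move=> x _; rewrite subr0.
have ord s t k : s <= t -> `|picard u t k - picard u s k| <= B * (t - s).
  move=> st; have [s0|s0] := leP 0 s; first exact: pos.
  rewrite [picard u s k]picard_neg// subr0.
  have [t0|t0] := leP 0 t; last first.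
    by rewrite picard_neg// normr0 mulr_ge0 ?subr_ge0// (bound_ge0 k).
  have := pos 0 t k (lexx _) t0; rewrite picard_0 !subr0 => /le_trans; apply.
  by rewrite ler_wpM2l ?(bound_ge0 k)//; lra.
move=> s t k; have [st|ts] := leP s t.
- by rewrite distrC (distrC s) (ger0_norm (x := t - s)) ?subr_ge0// ord.
- by rewrite (gtr0_norm (x := s - t)) ?subr_gt0// ord// ltW.
Qed.

Fixpoint picard_iter m : R -> 'I_K -> R :=
  if m is m'.+1 then picard (picard_iter m') else fun _ _ => 0.

Lemma picard_iter_lipschitz m : path_lipschitz (picard_iter m).
Proof.
elim: m => [|m IH] /=; last exact: picard_lipschitz.
by move=> s t k; rewrite subrr normr0 mulr_ge0// (bound_ge0 k).
Qed.

(** Successive iterates differ by O(2^-m) in the weighted norm, hence converge pointwise at that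
    rate. The limit inherits the Lipschitz bound, and contracting the distance between an iterate
    and the limit shows that the limit is a fixed point. *)
Lemma picard_exists : exists a, path_lipschitz a /\
  forall t k, a t k = Rintegral mu `[0, t] (fun s => f (a s) k).
Proof.
pose l : R := 2 * K.+1%:R * L.
have l0 : 0 < l by rewrite /l !mulr_gt0// ltr0n.
(* Every coordinate of the first iterate is at most |B| e^(l t) / l, so W bounds the first
   difference in the weighted norm. *)
pose W : R := K%:R * (`|B| / l).
have W0 : 0 <= W by rewrite mulr_ge0 ?divr_ge0// ltW.
have contr u v (w t : R) : path_lipschitz u -> path_lipschitz v -> 0 <= t -> 0 <= w ->
    (forall s, 0 <= s <= t -> dist1 (u s) (v s) <= w * expR (l * s)) ->
    dist1 (picard u t) (picard v t) <= w / 2 * expR (l * t).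
  move=> ul vl t0 w0 uv; apply: (@integral_contraction (fun=> True)) => //.
  - by move=> k; exact: field_path_integrable.
  - by move=> k; exact: field_path_integrable.
have step m t : 0 <= t ->
    dist1 (picard_iter m.+1 t) (picard_iter m t) <= W / 2 ^+ m * expR (l * t).
  elim: m t => [|m IH] t t0.
    rewrite expr0 divr1 /W -mulrA; apply: dist1_le_const => k /=.
    rewrite subr0; apply: Rintegral_le_expR => //.
      by apply: field_path_integrable; exact: (picard_iter_lipschitz 0).
    move=> x /andP[x0 _]; apply: le_trans (fB _ _) _.
    apply: le_trans (ler_norm _) _; rewrite ler_peMr// -[leLHS](@expR0 R) ler_expR mulr_ge0// ltW//.
  rewrite exprSr invfM mulrA /=; apply: contr => //.
  - exact: picard_lipschitz (picard_iter_lipschitz m).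
  - exact: picard_iter_lipschitz.
  - by rewrite divr_ge0// exprn_ge0.
  - by move=> s /andP[s0 _]; exact: IH.
(* The sum of the geometric series of the step bounds. Each bound is then written as a difference of
   two tails, so that the bounds telescope. *)
pose E (t : R) : R := 2 * W * expR (l * `|t|).
have E0 t : 0 <= E t by rewrite mulr_ge0 ?expR_ge0// mulr_ge0.
have step' m t k : `|picard_iter m.+1 t k - picard_iter m t k|
    <= E t / 2 ^+ m - E t / 2 ^+ m.+1.
  have -> : E t / 2 ^+ m - E t / 2 ^+ m.+1 = W / 2 ^+ m * expR (l * `|t|).
    have : 2 ^+ m != 0 :> R by rewrite expf_neq0.
    by rewrite /E exprS => m0; field.
  have [t0|t0] := leP 0 t.
    by rewrite (ger0_norm t0); apply: le_trans (ler_dist1 _ _ k) (step m t t0).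
  have it0 j : picard_iter j t k = 0 by case: j => [|j] //=; rewrite picard_neg.
  by rewrite !it0 subrr normr0 mulr_ge0 ?expR_ge0// divr_ge0// exprn_ge0.
have far t k m j : `|picard_iter (m + j) t k - picard_iter m t k|
    <= E t / 2 ^+ m - E t / 2 ^+ (m + j).
  elim: j => [|j IH]; first by rewrite addn0 !subrr normr0.
  rewrite addnS (le_trans (ler_distD (picard_iter (m + j) t k) _ _))//.
  by have := step' (m + j)%N t k; lra.
have pos m t : 0 <= E t / 2 ^+ m by rewrite divr_ge0// exprn_ge0.
have H t k : exists r : R, forall m, `|r - picard_iter m t k| <= E t / 2 ^+ m.
  apply: (@cauchy_rate _ (fun m => picard_iter m t k) (fun m => E t / 2 ^+ m)) => m j.
  have [mj|/ltnW jm] := leqP m j.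
  - rewrite distrC; have := far t k m (j - m)%N; rewrite subnKC//.
    by have := pos j t; lra.
  - have := far t k j (m - j)%N; rewrite subnKC//.
    by have := pos m t; lra.
pose a t k := projT1 (cid (H t k)).
have aE t k m : `|a t k - picard_iter m t k| <= E t / 2 ^+ m.
  by rewrite /a; case: cid.
have alip : path_lipschitz a.
  move=> s t k; rewrite -subr_le0; apply: (@le0_geometric _ _ (E s + E t)) => m.
  have := aE s k m; have := aE t k m; have := picard_iter_lipschitz m s t k.
  have := ler_distD (picard_iter m s k) (a s k) (a t k).
  have := ler_distD (picard_iter m t k) (picard_iter m s k) (a t k).
  rewrite (distrC (picard_iter m t k) (a t k)) mulrDl; lra.
exists a; split => // t k.
have [t0|t0] := leP 0 t; last first.
  rewrite [RHS]picard_neg//; apply/eqP; rewrite -normr_le0.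
  apply: (@le0_geometric _ _ (E t)) => m.
  have := aE t k m; have -> : picard_iter m t k = 0; last by rewrite subr0.
  by case: m => [|j] //=; rewrite picard_neg.
apply/eqP; rewrite -subr_eq0 -normr_le0.
(* The term E t accounts for the distance from the limit to iterate m + 1, the other one for the
   distance from iterate m + 1 to the image of the limit. *)
apply: (@le0_geometric _ _ (E t + K%:R * 2 * W * expR (l * t))) => m.
apply: le_trans (ler_distD (picard_iter m.+1 t k) _ _) _.
rewrite mulrDl lerD//.
  apply: le_trans (aE _ _ _) _; rewrite ler_wpM2l// lef_pV2 ?posrE ?exprn_gt0//.
  by rewrite exprS ler_peMl ?exprn_ge0// ler1n.
apply: le_trans (ler_dist1 _ (picard a t) k) _.
have w0 : 0 <= K%:R * 2 * W by apply: mulr_ge0 => //; apply: mulr_ge0.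
apply: le_trans (contr (picard_iter m) a (K%:R * 2 * W / 2 ^+ m) t
  (picard_iter_lipschitz m) alip t0 _ _) _.
  by apply: divr_ge0 => //; exact: exprn_ge0.
  move=> s /andP[s0 _]; rewrite dist1C.
  apply: le_trans (dist1_le_const (fun i => aE s i m)) _.
  by rewrite /E (ger0_norm s0) [leRHS]mulrAC -!mulrA.
rewrite [leRHS]mulrAC ler_wpM2r ?expR_ge0// ler_pdivrMr// ler_peMr ?ler1n//.
by apply: divr_ge0 => //; exact: exprn_ge0.
Qed.

End Picard.

(** * Bounded Lipschitz functions; regularity of the field *)

Section BoundedLipschitz.
Local Open Scope classical_set_scope.
Variables (R : realType) (K : nat) (S : ('I_K -> R) -> Prop).
Implicit Types (g h : ('I_K -> R) -> R).

(** Boundedness is included because Lipschitz functions alone are closed neither under products nor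
    under the exponential. One constant serves for both bounds. *)
Definition blip g := exists2 C : R, 0 <= C &
  (forall x, S x -> `|g x| <= C) /\
  (forall x y, S x -> S y -> `|g x - g y| <= C * dist1 x y).

Lemma blip_cst (r : R) : blip (fun=> r).
Proof.
exists `|r| => //; split=> // x y _ _.
by rewrite subrr normr0 mulr_ge0// dist1_ge0.
Qed.

Lemma blip_add g h : blip g -> blip h -> blip (fun x => g x + h x).
Proof.
move=> [C C0 [gC gL]] [D D0 [hD hL]]; exists (C + D); first exact: addr_ge0.
split=> [x Sx|x y Sx Sy].
  by apply: le_trans (ler_normD _ _) _; rewrite lerD ?gC ?hD.
rewrite opprD addrACA mulrDl; apply: le_trans (ler_normD _ _) _.
by rewrite lerD ?gL ?hL.
Qed.

Lemma blip_mul g h : blip g -> blip h -> blip (fun x => g x * h x).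
Proof.
move=> [C C0 [gC gL]] [D D0 [hD hL]]; exists (C * D + C * D).
  by rewrite addr_ge0// mulr_ge0.
split=> [x Sx|x y Sx Sy].
  rewrite normrM (@le_trans _ _ (C * D))//; last by rewrite lerDl mulr_ge0.
  by rewrite ler_pM ?gC ?hD.
have -> : g x * h x - g y * h y = (g x - g y) * h x + g y * (h x - h y) by ring.
apply: le_trans (ler_normD _ _) _; rewrite !normrM mulrDl lerD//.
  by rewrite mulrAC ler_pM ?gL ?hD.
by rewrite -mulrA ler_pM ?gC ?hL.
Qed.

Lemma blip_opp g : blip g -> blip (fun x => - g x).
Proof.
move=> [C C0 [gC gL]]; exists C => //; split=> [x Sx|x y Sx Sy].
  by rewrite normrN gC.
by rewrite -opprD normrN gL.
Qed.

Lemma blip_exp g n : blip g -> blip (fun x => g x ^+ n).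
Proof.
move=> gb; elim: n => [|n IH]; first exact: blip_cst.
have -> : (fun x => g x ^+ n.+1) = (fun x => g x * g x ^+ n).
  by apply/funext => x; rewrite exprS.
exact: blip_mul.
Qed.

Lemma blip_sum n (G : 'I_n -> ('I_K -> R) -> R) :
  (forall i, blip (G i)) -> blip (fun x => \sum_i G i x).
Proof.
elim: n G => [|n IH] G Gb.
  have -> : (fun x => \sum_i G i x) = fun=> 0 by apply/funext => x; rewrite big_ord0.
  exact: blip_cst.
have -> : (fun x => \sum_i G i x)
    = (fun x => \sum_(i < n) G (widen_ord (leqnSn n) i) x + G ord_max x).
  by apply/funext => x; rewrite big_ord_recr.
by apply: blip_add => //; apply: IH.
Qed.

(** For v <= u one has e^u - e^v = e^u (1 - e^(v - u)), and 1 - e^(-x) <= x. *)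
Lemma expR_lipschitz (u v C : R) : u <= C -> v <= C ->
  `|expR u - expR v| <= expR C * `|u - v|.
Proof.
wlog uv : u v / v <= u.
  move=> W uC vC; have [vu|/ltW uv] := leP v u; first exact: W.
  by rewrite distrC (distrC u) W.
move=> uC _; rewrite !ger0_norm ?subr_ge0 ?ler_expR//.
have -> : expR u - expR v = expR u * (1 - expR (v - u)).
  by rewrite mulrBr mulr1 -expRD [u + _]addrC subrK.
apply: ler_pM => //.
- by rewrite subr_ge0 -[leRHS]expR0 ler_expR subr_le0.
- by rewrite ler_expR.
- by have := expR_ge1Dx (v - u); lra.
Qed.

Lemma blip_expR g : blip g -> blip (fun x => expR (g x)).
Proof.
move=> [C C0 [gC gL]]; exists (expR C * (C + 1)).
  by rewrite mulr_ge0 ?expR_ge0// addr_ge0.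
split=> [x Sx|x y Sx Sy].
  rewrite ger0_norm ?expR_ge0// (@le_trans _ _ (expR C))//.
    by rewrite ler_expR (le_trans (ler_norm _))// gC.
  by rewrite ler_peMr ?expR_ge0// lerDr.
apply: le_trans (expR_lipschitz (le_trans (ler_norm _) (gC _ Sx))
  (le_trans (ler_norm _) (gC _ Sy))) _.
rewrite -mulrA ler_pM2l ?expR_gt0// (le_trans (gL _ _ Sx Sy))//.
by rewrite ler_wpM2r ?dist1_ge0// lerDl.
Qed.

Hypothesis Sbox : exists M, forall x k, S x -> `|x k| <= M.

Lemma blip_coord k : blip (fun x => x k).
Proof.
have [M SM] := Sbox; exists (`|M| + 1); first exact: addr_ge0.
split=> [x Sx|x y _ _].
  by rewrite (le_trans (SM _ _ Sx))// (le_trans (ler_norm _))// lerDl.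
rewrite (le_trans (ler_dist1 x y k))// ler_peMl ?dist1_ge0//.
by rewrite lerDr.
Qed.

Lemma blip_aget j : blip (fun x => aget x j).
Proof.
rewrite /aget; case: insubP => [i _ _|_]; [exact: blip_coord|exact: blip_cst].
Qed.

Lemma blip_delta (c : R) k : blip (fun x => delta c x k).
Proof.
have sb m : blip (fun x => asum_lt x m).
  by apply: blip_sum => i; exact: blip_aget.
have eb : blip (fun x => Efac c x).
  by apply/blip_expR/blip_opp/blip_mul; [exact: blip_cst|exact: sb].
have Tb r : blip (fun x => c ^+ r * aK2 x ^+ r / (r`!)%:R).
  apply: blip_mul; last exact: blip_cst.
  by apply: blip_mul; [exact: blip_cst|exact/blip_exp/sb].
have Sb : blip (fun x => Sfun c x) by apply: blip_sum => r; exact: Tb.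
have cb j : blip (fun x => c * aget x j).
  by apply: blip_mul; [exact: blip_cst|exact: blip_aget].
rewrite /delta; case: (k == 0%N); [|case: (k == K.-1)]; apply: blip_add => //.
- by apply: blip_mul => //; apply: blip_mul => //; exact: blip_opp.
- by apply: blip_mul => //; apply: blip_mul.
- exact: blip_mul.
- apply: blip_mul => //; apply: blip_mul => //; apply: blip_mul; first exact: blip_cst.
  by apply: blip_add; [exact: blip_aget|exact/blip_opp/blip_aget].
- exact: blip_mul.
Qed.

(** It is applied with S the unit cube, for the clamped field, and with S a box containing two given
    solutions, for uniqueness. *)
Lemma delta_bounded_lipschitz (c : R) : exists2 C : R, 0 < C &
  (forall x (k : 'I_K), S x -> `|delta c x k| <= C) /\
  (forall x y (k : 'I_K), S x -> S y ->
     `|delta c x k - delta c y k| <= C * dist1 x y).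
Proof.
have H (k : 'I_K) : {C : R | 0 <= C & (forall x, S x -> `|delta c x k| <= C) /\
  (forall x y, S x -> S y -> `|delta c x k - delta c y k| <= C * dist1 x y)}.
  by apply: cid2; exact: blip_delta.
(* The sum over the levels stands in for a maximum. *)
pose D : R := \sum_k s2val (H k).
have leD k : s2val (H k) <= D.
  by rewrite /D (bigD1 k)//= lerDl sumr_ge0// => i _; exact: (s2valP (H i)).
have D0 : 0 <= D by rewrite sumr_ge0// => i _; exact: (s2valP (H i)).
exists (D + 1); first by rewrite ltr_wpDl.
split=> [x k Sx|x y k Sx Sy]; have [HB HL] := s2valP' (H k).
  by rewrite (le_trans (HB x Sx))// (le_trans (leD k))// lerDl.
rewrite (le_trans (HL x y Sx Sy))// ler_wpM2r ?dist1_ge0//.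
by rewrite (le_trans (leD k))// lerDl.
Qed.

End BoundedLipschitz.

(** * Existence for the clamped equations and uniqueness *)

Section Clamp.
Local Open Scope classical_set_scope.
Variables (R : realType) (K : nat).
Implicit Types (x y : 'I_K -> R).

Definition clamp01 (r : R) : R := Num.max 0 (Num.min r 1).

Lemma clamp01_itv r : 0 <= clamp01 r <= 1.
Proof. by rewrite /clamp01 le_max lexx ge_max ler01 ge_min lexx orbT. Qed.

Lemma clamp01_id r : 0 <= r <= 1 -> clamp01 r = r.
Proof. by move=> /andP[r0 r1]; rewrite /clamp01 min_l// max_r. Qed.

Lemma clamp01_dist r s : `|clamp01 r - clamp01 s| <= `|r - s|.
Proof.
have H (a b : R) : a <= b -> 0 <= clamp01 b - clamp01 a <= b - a.
  by rewrite /clamp01 !(maxElt, minElt) => ab; repeat case: ifP => //; lra.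
have [rs|/ltW sr] := leP r s.
- by have /andP[? ?] := H _ _ rs; rewrite distrC (distrC r) (ger0_norm (x := s - r)) ?subr_ge0// ger0_norm.
- by have /andP[? ?] := H _ _ sr; rewrite (ger0_norm (x := r - s)) ?subr_ge0// ger0_norm.
Qed.

Definition clamped_delta (c : R) x (k : 'I_K) : R := delta c (clamp01 \o x) k.

Lemma clamped_delta_id (c : R) x k : (forall i, 0 <= x i <= 1) ->
  clamped_delta c x k = delta c x k.
Proof.
move=> x01; rewrite /clamped_delta; congr (delta _ _ _).
by apply/funext => i /=; rewrite clamp01_id.
Qed.

Lemma clamped_delta_bounded_lipschitz (c : R) : exists2 C : R, 0 < C &
  (forall x k, `|clamped_delta c x k| <= C) /\
  (forall x y k, `|clamped_delta c x k - clamped_delta c y k| <= C * dist1 x y).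
Proof.
pose S x := forall i : 'I_K, 0 <= x i <= 1.
have [|C C0 [CB CL]] := @delta_bounded_lipschitz R K S _ c.
  by exists 1 => x k /(_ k) /andP[x0 x1]; rewrite ger0_norm.
have Scl x : S (clamp01 \o x) by move=> i; exact: clamp01_itv.
exists C => //; split=> [x k|x y k]; first exact: CB.
apply: le_trans (CL _ _ k (Scl x) (Scl y)) _.
by rewrite ler_pM2l// ler_sum// => i _; exact: clamp01_dist.
Qed.

(** The constant is returned together with the solution, because the second moment estimate uses it
    as a Lipschitz constant of both the field and the path. *)
Lemma clamped_solution_exists (c : R) : exists (C : R) (a : R -> 'I_K -> R),
  [/\ 0 < C, forall x k, `|clamped_delta c x k| <= C,
    forall x y k, `|clamped_delta c x k - clamped_delta c y k| <= C * dist1 x y,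
    path_lipschitz C a &
    forall t k, lebesgue_measure.-integrable `[0, t]
        (EFin \o (fun s => clamped_delta c (a s) k)) /\
      a t k = Rintegral lebesgue_measure `[0, t] (fun s => clamped_delta c (a s) k)].
Proof.
have [C C0 [CB CL]] := clamped_delta_bounded_lipschitz c.
have [a [alip aE]] := picard_exists C0 CB CL.
exists C, a; split=> // t k; split; last exact: aE.
exact: (field_path_integrable C0 CB CL).
Qed.

(** A solution is not known beforehand to stay in [0,1], but it is bounded by the integral of
    |delta| over [0,1]. Two solutions therefore lie in a common box, on which delta is Lipschitz,
    and the contraction halves their weighted distance any number of times. *)
Lemma solution_unique (c : R) (a b : R -> 'I_K -> R) :
  is_solution c a -> is_solution c b -> forall t, 0 <= t <= 1 -> b t = a t.
Proof.
move=> sa sb.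
have bnd (d : R -> 'I_K -> R) : is_solution c d ->
    exists2 M : R, 0 <= M & forall t k, 0 <= t <= 1 -> `|d t k| <= M.
  move=> sd; pose N (k : 'I_K) := Rintegral lebesgue_measure `[0, 1] (fun s => `|delta c (d s) k|).
  have N0 k : 0 <= N k by apply: Rintegral_ge0.
  exists (\sum_k N k) => [|t k t01]; first exact: sumr_ge0.
  have [di ->] := sd k t t01; apply: le_trans (le_normr_Rintegral _ di) _ => //.
  apply: (@le_trans _ _ (N k)); last by rewrite (bigD1 k)//= lerDl sumr_ge0.
  have [di1 _] := sd k 1 (introT andP (conj ler01 (lexx 1))).
  rewrite /N /Rintegral fine_le//.
  - exact/integrable_fin_num/(integrable_norm di).
  - exact/integrable_fin_num/(integrable_norm di1).
  - apply: ge0_subset_integral => //.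
    + by case/integrableP: (integrable_norm di1).
    + by apply: subset_itvl; rewrite bnd_simp; case/andP: t01.
have [M M0 aM] := bnd _ sa; have [N N0 bN] := bnd _ sb.
pose S (x : 'I_K -> R) := forall k, `|x k| <= M + N.
have [|L L0 [_ dL]] := @delta_bounded_lipschitz R K S _ c.
  by exists (M + N) => x k Sx; exact: Sx.
pose W := K%:R * (M + N).
pose l := 2 * K.+1%:R * L.
have l0 : 0 < l by rewrite /l !mulr_gt0// ltr0n.
have W0 : 0 <= W by rewrite mulr_ge0// addr_ge0.
have main m t : 0 <= t <= 1 -> dist1 (a t) (b t) <= W / 2 ^+ m * expR (l * t).
  elim: m t => [|m IH] t t01; have /andP[t0 t1] := t01.
    rewrite expr0 divr1 (@le_trans _ _ W)//.
      apply: dist1_le_const => k; apply: le_trans (ler_normB _ _) _.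
      by rewrite lerD ?aM ?bN.
    by rewrite ler_peMr// -[leLHS](@expR0 R) ler_expR mulr_ge0// ltW.
  have sub s : 0 <= s <= t -> 0 <= s <= 1.
    by move=> /andP[-> st]; rewrite (le_trans st).
  have -> : a t = (fun k => Rintegral lebesgue_measure `[0, t] (fun s => delta c (a s) k)).
    by apply/funext => k; have [] := sa k t t01.
  have -> : b t = (fun k => Rintegral lebesgue_measure `[0, t] (fun s => delta c (b s) k)).
    by apply/funext => k; have [] := sb k t t01.
  rewrite exprSr invfM mulrA.
  apply: (@integral_contraction R K (fun x k => delta c x k) L S) => //.
  - by rewrite divr_ge0// exprn_ge0.
  - move=> s /sub s01; split=> k.
      by rewrite (le_trans (aM _ _ s01))// lerDl.
    by rewrite (le_trans (bN _ _ s01))// lerDr.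
  - by move=> k; have [] := sa k t t01.
  - by move=> k; have [] := sb k t t01.
  - by move=> s /sub; exact: IH.
move=> t t01; apply/esym/dist1_eq0.
apply: (@le0_geometric _ _ (W * expR (l * t))) => m.
by rewrite mulrAC main.
Qed.

End Clamp.

(** * Random subsets and the Markov property *)

Section RandomSubset.
Import mathcomp.boot.fintype mathcomp.boot.finset.
Variables (R : realType) (p : R).

(* The mean of f over the random subset of U that contains each element
   independently with probability p. *)
Definition bern (T : finType) (U : {set T}) (f : {set T} -> R) : R :=
  \sum_(E : {set T} | E \subset U)
     p ^+ #|E| * (1 - p) ^+ (#|U| - #|E|) * f E.

Lemma eq_bern (T : finType) (U : {set T}) (f g : {set T} -> R) :
  (forall E : {set T}, E \subset U -> f E = g E) -> bern U f = bern U g.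
Proof. by move=> fg; apply: eq_bigr => E EU; rewrite fg. Qed.

Lemma bern_add (T : finType) (U : {set T}) (f g : {set T} -> R) :
  bern U (fun E => f E + g E) = bern U f + bern U g.
Proof. by rewrite /bern -big_split; apply: eq_bigr => E _; rewrite mulrDr. Qed.

Lemma bern_scale (T : finType) (U : {set T}) (r : R) (f : {set T} -> R) :
  bern U (fun E => r * f E) = r * bern U f.
Proof. by rewrite /bern big_distrr; apply: eq_bigr => E _; rewrite mulrCA. Qed.

Lemma bern_sum (T I : finType) (U : {set T}) (P : pred I) (f : I -> {set T} -> R) :
  bern U (fun E => \sum_(i | P i) f i E) = \sum_(i | P i) bern U (f i).
Proof.
rewrite /bern exchange_big; apply: eq_bigr => E _.
by rewrite big_distrr.
Qed.

(** The traces of the random set on disjoint U and V are independent: E corresponds to the pair of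
    its intersections with U and V, and the weights multiply. *)
Lemma bern_union (T : finType) (U V : {set T}) (f : {set T} -> R) :
  [disjoint U & V] ->
  bern (U :|: V) f = bern U (fun E => bern V (fun F => f (E :|: F))).
Proof.
move=> dUV; rewrite /bern.
under [RHS]eq_bigr do rewrite big_distrr /=.
rewrite pair_big_dep /=.
rewrite (reindex_onto (fun q : {set T} * {set T} => q.1 :|: q.2)
  (fun E => (E :&: U, E :&: V))) /=; last first.
  by move=> E; rewrite -setIUr => /setIidPl.
apply: eq_big => [[E F]|[E F]] /=.
  apply/andP/andP => [[EF /eqP[<- <-]]|[EU FV]]; first by rewrite !subsetIr.
  split; first by rewrite setUSS.
  rewrite !setIUl (setIidPl EU) (setIidPl FV).
  have -> : F :&: U = set0.
    by apply/eqP; rewrite setI_eq0 disjoint_sym (disjointWr FV).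
  have -> : E :&: V = set0.
    by apply/eqP; rewrite setI_eq0 (disjointWl EU).
  by rewrite setU0 set0U.
move=> /andP[_ /eqP[eE eF]].
have EU : E \subset U by rewrite -eE subsetIr.
have FV : F \subset V by rewrite -eF subsetIr.
have dEF : E :&: F = set0.
  by apply/eqP; rewrite setI_eq0 (disjointWl EU)// (disjointWr FV).
have dU : U :&: V = set0 by apply/eqP; rewrite setI_eq0.
rewrite !cardsU dEF dU !cards0 !subn0 mulrA; congr (_ * _).
have -> : (#|U| + #|V| - (#|E| + #|F|) = (#|U| - #|E|) + (#|V| - #|F|))%N.
  by have := subset_leq_card EU; have := subset_leq_card FV; lia.
by rewrite !exprD; ring.
Qed.

Lemma bern_imset (S T : finType) (h : S -> T) (U : {set S}) (f : {set T} -> R) :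
  {in U &, injective h} ->
  bern (h @: U) f = bern U (fun E => f (h @: E)).
Proof.
move=> hi; rewrite /bern.
rewrite (reindex_onto (fun E : {set S} => h @: E)
  (fun F => [set x in U | h x \in F])) /=; last first.
  move=> F FU; apply/setP => y; apply/imsetP/idP => [[x]|yF].
    by rewrite inE => /andP[_ hx] ->.
  have /imsetP[x xU yE] := subsetP FU y yF.
  by exists x => //; rewrite inE xU -yE.
have key (E : {set S}) : E \subset U -> [set x in U | h x \in h @: E] = E.
  move=> EU; apply/setP => x; rewrite inE; apply/andP/idP => [[xU]|xE].
    by move=> /imsetP[y yE /hi -> //]; exact: (subsetP EU).
  by split; [exact: (subsetP EU)|exact: imset_f].
apply: eq_big => [E|E].
  apply/andP/idP => [[_ /eqP <-]|EU]; first by apply/subsetP => x; rewrite inE => /andP[].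
  by rewrite key// imsetS.
move=> /andP[_ /eqP eE].
have EU : E \subset U by rewrite -eE; apply/subsetP => x; rewrite inE => /andP[].
rewrite !card_in_imset// => x y xE yE; apply: hi; exact: (subsetP EU).
Qed.

Lemma sum_subsets_card_eq (T : finType) (U : {set T}) (F : nat -> R) k :
  \sum_(E : {set T} | (E \subset U) && (#|E| == k)) F #|E| =
  ('C(#|U|, k))%:R * F k.
Proof.
rewrite (eq_bigr (fun=> F k)); last by move=> E /andP[_ /eqP ->].
by rewrite sumr_const -cards_draws mulr_natl cardsE.
Qed.

Lemma sum_subsets_card_lt (T : finType) (U : {set T}) (F : nat -> R) m :
  \sum_(E : {set T} | (E \subset U) && (#|E| < m)%N) F #|E| =
  \sum_(k < m) ('C(#|U|, k))%:R * F k.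
Proof.
elim: m => [|m IH]; first by rewrite big_ord0 big1// => E; rewrite andbF.
rewrite big_ord_recr /= -IH -sum_subsets_card_eq.
rewrite (bigID (fun E : {set T} => #|E| < m)%N) /=; congr (_ + _); apply: eq_bigl => E.
  by rewrite -andbA; congr (_ && _); case: ltngtP (leqnSn m) => //; lia.
by rewrite -andbA; congr (_ && _); lia.
Qed.

(** Total mass one is the binomial theorem for (1 - p) + p. Together with [bern_union] it averages
    out the coordinates on which a function does not depend. *)
Lemma bern_cst (T : finType) (U : {set T}) (r : R) : bern U (fun=> r) = r.
Proof.
rewrite /bern -big_distrl /=.
rewrite (eq_bigl (fun E : {set T} => (E \subset U) && (#|E| < #|U|.+1)%N)); last first.
  move=> E; case: (boolP (E \subset U)) => //= EU.
  by rewrite ltnS subset_leq_card.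
rewrite (sum_subsets_card_lt U (fun k => p ^+ k * (1 - p) ^+ (#|U| - k))).
have := exprDn (1 - p) p #|U|; rewrite subrK expr1n => e1.
rewrite (_ : \sum_(k < _) _ = 1) ?mul1r// [RHS]e1.
by apply: eq_bigr => i _; rewrite mulr_natl [p ^+ i * _]mulrC.
Qed.

Hypothesis p01 : 0 <= p <= 1.

Lemma bern_le (T : finType) (U : {set T}) (f g : {set T} -> R) :
  (forall E : {set T}, E \subset U -> f E <= g E) -> bern U f <= bern U g.
Proof.
move=> fg; apply: ler_sum => E EU; rewrite ler_wpM2l ?fg//.
by have /andP[p0 p1] := p01; rewrite mulr_ge0 ?exprn_ge0// subr_ge0.
Qed.


End RandomSubset.

(** * The exploration as a Markov chain *)

Section Step.
Import mathcomp.boot.fintype mathcomp.boot.finset.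
Variables (K n : nat).
Implicit Types (s : 'S_n) (E : {set 'I_n * 'I_n}) (st : 'I_n -> vstat).
Implicit Types (u v w : 'I_n) (N : {set 'I_n}).

(** The exploration step with the active neighbourhood N as an argument, so that N can be replaced
    by a random set independent of the state. *)
Definition stepN v st N : 'I_n -> vstat :=
  if (#|N| < K)%N && [forall u in N, lvl (st u) != K.-1] then
    fun u => if u == v then InA #|N|
             else if u \in N then InA (lvl (st u)).+1 else st u
  else fun u => if u == v then InB else st u.

Definition Aset st : {set 'I_n} := [set u | inAany (st u)].

Lemma exploreS s E m (mn : (m < n)%N) :
  explore K s E m.+1 =
  stepN (s (Ordinal mn)) (explore K s E m)
    [set u in Aset (explore K s E m) | adj E u (s (Ordinal mn))].
Proof.
(* The neighbourhood in [explore_step] is a classical set; it is identified here with a finite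
   set. *)
have nbE u : (u \in [set u | inAany (explore K s E m u) && adj E u (s (Ordinal mn))]%classic)
   = (u \in [set u in Aset (explore K s E m) | adj E u (s (Ordinal mn))]).
  by rewrite !inE; apply/asboolP/idP.
rewrite /= /explore_step insubT /= /stepN (eq_card nbE) (eq_forallb (P2 := fun u =>
  (u \in [set u in Aset (explore K s E m) | adj E u (s (Ordinal mn))]) ==>
  (lvl (explore K s E m u) != K.-1))); last by move=> u; rewrite nbE.
by case: ifP => // _; apply/funext => u; rewrite nbE.
Qed.

Definition seen s m : {set 'I_n} := [set u | (s^-1 u < m)%N]%g.

Lemma seenS s m (mn : (m < n)%N) u :
  (u \in seen s m.+1) = (u == s (Ordinal mn)) || (u \in seen s m).
Proof.
rewrite !inE ltnS leq_eqVlt; congr (_ || _).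
rewrite -[RHS](inj_eq (@perm_inj _ s^-1)%g) permK -val_eqE //.
Qed.

Lemma last_notin_seen s m (mn : (m < n)%N) : s (Ordinal mn) \notin seen s m.
Proof. by rewrite inE permK /= ltnn. Qed.

Lemma explore_unseen s E m u : u \notin seen s m -> explore K s E m u = Unexpl.
Proof.
elim: m => [//|m IH]; have [mn|nm] := ltnP m n; last first.
  move=> us; rewrite /= /explore_step insubF ?IH//; last by rewrite ltnNge nm.
  apply: contra us; rewrite !inE => /leq_trans; exact.
rewrite exploreS (seenS _ mn) negb_or => /andP[uv us].
rewrite /stepN; case: ifP => _; rewrite (negbTE uv) ?IH// ifF//.
by rewrite !inE IH.
Qed.

Lemma Aset_seen s E m : Aset (explore K s E m) \subset seen s m.
Proof.
apply/subsetP => u; rewrite inE; apply: contraLR => us.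
by rewrite explore_unseen.
Qed.

Lemma explore_lvl s E m u : (0 < K)%N -> (lvl (explore K s E m u) < K)%N.
Proof.
move=> K0; elim: m u => [|m IH] u //.
have [mn|nm] := ltnP m n; last first.
  by rewrite /= /explore_step insubF ?IH//; rewrite ltnNge nm.
rewrite exploreS /stepN; case: ifP => [/andP[NK /forallP H]|_].
  case: eqP => // _; case: ifP => // uN /=.
  have := H u; rewrite uN /= => lK; have := IH u; rewrite leq_eqVlt => /predU1P[eK|].
    by case/eqP: lK; rewrite -[X in _ = X.-1]eK.
  by [].
by case: eqP.
Qed.

(** The first m steps inspect only edges between vertices selected by then. *)
Lemma explore_ext s E F m :
  (forall u w, u \in seen s m -> w \in seen s m -> adj E u w = adj F u w) ->
  explore K s E m = explore K s F m.
Proof.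
elim: m => [//|m IH] EF; have [mn|nm] := ltnP m n; last first.
  rewrite /= /explore_step insubF ?IH//; last by rewrite ltnNge nm.
  move=> u w us ws; apply: EF; move: us ws; rewrite !inE.
    by move=> /ltnW. by move=> _ /ltnW.
have EF' u w : u \in seen s m -> w \in seen s m -> adj E u w = adj F u w.
  by move=> us ws; apply: EF; rewrite (seenS _ mn) (us, ws) orbT.
rewrite !exploreS IH//; congr stepN; apply/setP => u; rewrite !inE.
case: (boolP (inAany _)) => //= uA; apply: EF; last by rewrite (seenS _ mn) eqxx.
rewrite (seenS _ mn); apply/orP; right; apply: (subsetP (Aset_seen s F m)).
by rewrite inE.
Qed.

Definition edge v u : 'I_n * 'I_n := if (u < v)%N then (u, v) else (v, u).

Lemma edge_inj v : injective (edge v).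
Proof.
move=> u w; rewrite /edge; case: ifP => uv; case: ifP => wv; case=> //.
  by move=> -> <-.
by move=> <- ->.
Qed.

Lemma edge_upper u v : u != v -> edge v u \in upper_pairs n.
Proof.
move=> uv; rewrite inE /edge; case: ifP => //= /negbT; rewrite -leqNgt leq_eqVlt.
by case/predU1P => // /val_inj e; rewrite e eqxx in uv.
Qed.

Lemma adj_edge E u v : E \subset upper_pairs n -> u != v ->
  adj E u v = (edge v u \in E).
Proof.
move=> EU uv; rewrite /adj uv /= /edge.
have H (a b : 'I_n) : (a < b)%N -> ((b, a) \in E) = false.
  by move=> ab; apply/negP => /(subsetP EU); rewrite inE /= ltnNge ltnW.
have [uv'|vu] := ltnP u v; first by rewrite (H _ _ uv') orbF.
rewrite (H v u) ?orFb//; move: vu; rewrite leq_eqVlt => /predU1P[/val_inj e|//].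
by rewrite e eqxx in uv.
Qed.

Variables (R : realType) (p : R).

(** The pairs joining the new vertex v to earlier vertices are uninspected before this step, so they
    are independent of the current state. Those leading to active vertices make up the random
    neighbourhood N. *)
Lemma markov_step s m (mn : (m < n)%N) (G : ('I_n -> vstat) -> R) :
  bern p (upper_pairs n) (fun E => G (explore K s E m.+1)) =
  bern p (upper_pairs n) (fun E => bern p (Aset (explore K s E m))
    (fun N => G (stepN (s (Ordinal mn)) (explore K s E m) N))).
Proof.
set v := s (Ordinal mn); pose P := seen s m.
have vP : v \notin P by exact: last_notin_seen.
(* C consists of the pairs joining v to earlier vertices, U of all other pairs; the state after m
   steps depends on U only. *)
pose C := edge v @: P; pose U := upper_pairs n :\: C.
have nev u : u \in P -> u != v by apply: contraTneq => ->.
have CU : C \subset upper_pairs n.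
  by apply/subsetP => e /imsetP[u uP ->]; apply: edge_upper; exact: nev.
have defU : upper_pairs n = U :|: C.
  by rewrite /U setDE setUIl [_ :|: C]setUC (setUC _ C) setUCr setIT (setUidPr CU).
have dUC : [disjoint U & C].
  by rewrite -setI_eq0 setIC setIDA setIC -setIDA setDv setI0.
have expl (E F : {set 'I_n * 'I_n}) : E \subset U -> F \subset C ->
    explore K s (E :|: F) m = explore K s E m.
  move=> EU FC; apply: explore_ext => u w uP wP.
  have sub : E :|: F \subset upper_pairs n by rewrite defU setUSS.
  have [-> |uw] := eqVneq u w; first by rewrite /adj eqxx.
  rewrite !adj_edge//; last by rewrite (subset_trans EU)// subsetDl.
  rewrite inE orbC; case: (boolP (_ \in F)) => // /(subsetP FC) /imsetP[x xP].
  rewrite /edge; do 2 case: ifP => _; case=> e1 e2.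
  - by rewrite -e2 wP in vP.
  - by rewrite -e1 uP in vP.
  - by rewrite -e2 uP in vP.
  - by rewrite -e1 wP in vP.
rewrite defU !bern_union//; apply: eq_bern => E EU.
pose st := explore K s E m; pose A := Aset st.
have AP : A \subset P by exact: Aset_seen.
transitivity (bern p A (fun N => G (stepN v st N))); last first.
  (* Once E is fixed the inner mean is the same for all F, so averaging over C changes nothing. *)
  rewrite -[LHS](bern_cst p C); apply: eq_bern => F FC.
  by rewrite (expl E F).
transitivity (bern p C (fun F => G (stepN v st [set u in A | edge v u \in F]))).
  apply: eq_bern => F FC; rewrite exploreS (expl E F)// -/st -/A -/v.
  congr (G (stepN _ _ _)); apply/setP => u; rewrite !inE -/A.
  have sub : E :|: F \subset upper_pairs n by rewrite defU setUSS.
  case: (boolP (inAany (st u))) => //= uA.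
  have uP : u \in P by apply: (subsetP AP); rewrite inE.
  rewrite adj_edge ?nev// inE; case: (boolP (_ \in E)) => // /(subsetP EU).
  by rewrite inE imset_f.
rewrite /C bern_imset; last by move=> x y _ _; exact: edge_inj.
(* Edges from v to earlier inactive vertices do not affect the step and are averaged out. *)
have -> : P = A :|: (P :\: A) by rewrite -[LHS](setID P A) (setIidPr AP).
rewrite bern_union; last by rewrite -setI_eq0 setIDA setIC -setIDA setDv setI0.
apply: eq_bern => N NA; rewrite -[RHS](bern_cst p (P :\: A)).
apply: eq_bern => M MPA; congr (G (stepN _ _ _)); apply/setP => u.
rewrite inE mem_imset; last exact: edge_inj.
rewrite !inE; case: (boolP (u \in N)) => [uN|uN] /=.
  by have := subsetP NA u uN; rewrite inE => ->.
by apply/negP => /andP[uA /(subsetP MPA)]; rewrite !inE uA.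
Qed.

End Step.

(** * Poisson approximation and expected increments *)

Section Poisson.
Variables (R : realType) (c : R).
Hypothesis c0 : 0 < c.

Lemma ler_distM (a b a' b' A B eA eB : R) :
  `|a| <= A -> `|b'| <= B -> `|a - a'| <= eA -> `|b - b'| <= eB ->
  `|a * b - a' * b'| <= A * eB + eA * B.
Proof.
move=> aA bB ea eb.
have -> : a * b - a' * b' = a * (b - b') + (a - a') * b' by ring.
by apply: le_trans (ler_normD _ _) _; rewrite !normrM lerD// ler_pM.
Qed.

(** From below, e^(-x) >= 1 - x; from above, e^(-x) <= 1 / (1 + x) <= 1 - x + x^2. *)
Lemma expR_quadratic (x : R) : 0 <= x -> `|expR (- x) - (1 - x)| <= x ^+ 2.
Proof.
move=> x0; rewrite ger0_norm; last by have := expR_ge1Dx (- x); lra.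
have e1 := expR_ge1Dx x; rewrite expRN.
have x1 : 0 < 1 + x by lra.
apply: (@le_trans _ _ ((1 + x)^-1 - (1 - x))).
  by rewrite lerD2r lef_pV2 ?posrE ?expR_gt0.
rewrite lerBlDr -[leLHS]mul1r ler_pdivrMr// expr2.
by have := mulr_ge0 (mulr_ge0 x0 x0) x0; lra.
Qed.

Lemma ler_distX (x y : R) m : 0 <= x <= 1 -> 0 <= y <= 1 ->
  `|x ^+ m - y ^+ m| <= m%:R * `|x - y|.
Proof.
move=> /andP[x0 x1] /andP[y0 y1]; elim: m => [|m IH].
  by rewrite !expr0 subrr normr0 mul0r.
rewrite !exprS -natr1 mulrDl -[m%:R * _]mul1r [1 * `|_|]mulrC.
apply: ler_distM => //; first by rewrite ger0_norm.
by rewrite ger0_norm ?exprn_ge0// exprn_ile1.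
Qed.

(** With p = c/n, replacing (1 - p)^L by e^(-p L) costs at most L p^2 <= c^2/n, and replacing L by M
    in the exponent costs at most p (M - L) <= k c/n. *)
Lemma expR_approx (n L M k : nat) : (0 < n)%N -> c <= n%:R -> (L <= M <= n)%N ->
  (M <= L + k)%N ->
  `|(1 - c / n%:R) ^+ L - expR (- (c * (M%:R / n%:R)))| <= (c ^+ 2 + k%:R * c) / n%:R.
Proof.
move=> n0 cn /andP[LM Mn] MLk.
have n0' : 0 < n%:R :> R by rewrite ltr0n.
set p := c / n%:R.
have p0 : 0 <= p by rewrite divr_ge0// ltW.
have p1 : p <= 1 by rewrite ler_pdivrMr// mul1r.
have -> : c * (M%:R / n%:R) = p * M%:R by rewrite /p mulrAC mulrA.
apply: le_trans (ler_distD (expR (- (p * L%:R))) _ _) _.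
rewrite mulrDl lerD//.
  rewrite (_ : - (p * L%:R) = - p * L%:R); last by rewrite mulNr.
  rewrite expRM_natr.
  apply: le_trans (ler_distX _ _ _) _.
  - by rewrite subr_ge0 p1 gerBl p0.
  - by rewrite expR_ge0 -[leRHS](@expR0 R) ler_expR oppr_le0 p0.
  rewrite distrC; apply: (@le_trans _ _ (n%:R * p ^+ 2)).
    by rewrite ler_pM ?ler_nat ?(leq_trans LM)// expR_quadratic.
  by rewrite /p le_eqVlt; apply/orP; left; apply/eqP; field; rewrite gt_eqF.
have pos j : - (p * j%:R) <= 0 by rewrite oppr_le0 mulr_ge0.
apply: le_trans (expR_lipschitz (pos L) (pos M)) _.
rewrite expR0 mul1r opprK addrC -mulrBr -natrB// normrM !ger0_norm//.
by rewrite mulrC /p mulrA ler_pM2r ?invr_gt0// ler_pM2r// ler_nat; lia.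
Qed.

(** Each factor m - i of the falling factorial, truncated at 0, differs from m' by at most i + 1.
    After scaling by c/n this is an error O(1/n) per factor, and all factors stay bounded by c. *)
Lemma ffact_approx k : exists2 A : R, 0 <= A & forall n m m' : nat,
  (0 < n)%N -> (m <= m' <= m.+1)%N -> (m' <= n)%N ->
  `|(m ^_ k)%:R * (c / n%:R) ^+ k - (c * (m'%:R / n%:R)) ^+ k| <= A / n%:R.
Proof.
elim: k => [|k [A A0 IH]].
  by exists 0 => // n m m' _ _ _; rewrite ffactn0 !expr0 mulr1 subrr normr0 mul0r.
exists (c ^+ k * (k.+1%:R * c) + A * c).
  by rewrite addr_ge0 ?mulr_ge0 ?exprn_ge0// ltW.
move=> n m m' n0 mm m'n; have n0' : 0 < n%:R :> R by rewrite ltr0n.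
have p0 : 0 <= c / n%:R by rewrite divr_ge0// ltW.
have frac (j : nat) : (j <= n)%N -> j%:R * (c / n%:R) <= c.
  by move=> jn; rewrite mulrA ler_pdivrMr// mulrC ler_pM2l// ler_nat.
rewrite ffactnSr natrM !exprSr mulrACA mulrDl.
rewrite (_ : c * (m'%:R / n%:R) = m'%:R * (c / n%:R)); last by rewrite mulrCA.
have IH' := IH n m m' n0 mm m'n.
rewrite -distrC -[_ / _ in leRHS]mulrA -[A * c / _]mulrAC.
rewrite distrC; apply: ler_distM.
- rewrite ger0_norm ?mulr_ge0 ?exprn_ge0//.
  apply: (@le_trans _ _ ((m ^ k)%:R * (c / n%:R) ^+ k)).
    rewrite ler_wpM2r ?exprn_ge0// ler_nat; elim: (k) => [//|j IHj].
    by rewrite ffactnSr expnSr leq_mul// leq_subr.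
  rewrite natrX -exprMn lerXn2r ?nnegrE ?(ltW c0)//; first exact: mulr_ge0.
  by apply: frac; lia.
- by rewrite (ger0_norm (mulr_ge0 _ p0))// frac.
- by move: IH'; rewrite (_ : c * (m'%:R / n%:R) = m'%:R * (c / n%:R)) // mulrCA.
- rewrite -mulrBl normrM (ger0_norm p0) mulrA ler_pM2r ?invr_gt0// ler_pM2r//.
  rewrite distrC ger0_norm ?subr_ge0 ?ler_nat; last by lia.
  by rewrite -natrB ?ler_nat; lia.
Qed.

(* The slack between m and m' and between L and M allows for conditioning on
   one given vertex being a neighbour. *)
Lemma poisson_approx k : exists2 C : R, 0 <= C & forall n m m' L M : nat,
  (0 < n)%N -> c <= n%:R -> (m <= m' <= m.+1)%N -> (m' <= n)%N ->
  (L <= M <= n)%N -> (M <= L + k.+1)%N ->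
  `|'C(m, k)%:R * (c / n%:R) ^+ k * (1 - c / n%:R) ^+ L
     - expR (- (c * (M%:R / n%:R))) * (c ^+ k * (m'%:R / n%:R) ^+ k / k`!%:R)|
  <= C / n%:R.
Proof.
have [A A0 HA] := ffact_approx k.
exists ((1 * A + (c ^+ 2 + k.+1%:R * c) * c ^+ k) / k`!%:R).
  have c0' := ltW c0.
  by rewrite divr_ge0// addr_ge0// mulr_ge0// ?addr_ge0// ?mulr_ge0// ?exprn_ge0.
move=> n m m' L M n0 cn mm m'n LM ML.
have f0 : 0 < k`!%:R :> R by rewrite ltr0n fact_gt0.
have n0' : 0 < n%:R :> R by rewrite ltr0n.
have -> : 'C(m, k)%:R = (m ^_ k)%:R / k`!%:R :> R.
  by rewrite -bin_ffact natrM mulfK// gt_eqF.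
rewrite -exprMn; set e := expR _; set g := _ ^+ L.
rewrite (_ : _ - _ = (g * ((m ^_ k)%:R * (c / n%:R) ^+ k)
   - e * (c * (m'%:R / n%:R)) ^+ k) / k`!%:R); last by ring.
rewrite normrM normfV (ger0_norm (x := k`!%:R))// [leRHS]mulrAC.
rewrite ler_pM2r ?invr_gt0// [leRHS]mulrDl -[1 * A / _]mulrA [X in _ <= _ + X]mulrAC.
have p0 : 0 <= c / n%:R by rewrite divr_ge0// ltW.
have p1 : c / n%:R <= 1 by rewrite ler_pdivrMr// mul1r.
apply: ler_distM.
- rewrite ger0_norm ?exprn_ge0 ?subr_ge0// exprn_ile1// ?subr_ge0//.
  by rewrite gerBl.
- have x0 : 0 <= c * (m'%:R / n%:R) by rewrite mulr_ge0 ?divr_ge0// ltW.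
  rewrite (ger0_norm (exprn_ge0 _ x0)) lerXn2r ?nnegrE ?(ltW c0)//.
  by rewrite ler_piMr ?(ltW c0)// ler_pdivrMr// mul1r ler_nat.
- exact: expR_approx.
- exact: HA.
Qed.

End Poisson.

(** * Level counts: one-step changes and their exact means *)

Section Counts.
Import mathcomp.boot.fintype mathcomp.boot.finset.
Variables (K n : nat).
Implicit Types (st : 'I_n -> vstat) (u v : 'I_n) (N : {set 'I_n}).

Definition lev st k : {set 'I_n} := [set u | inA k (st u)].

Definition cnt st k : nat := #|lev st k|.

Definition accepts st N : bool :=
  (#|N| < K)%N && [forall u in N, lvl (st u) != K.-1].

Lemma cardset_sum (P : pred 'I_n) : #|[set u | P u]| = (\sum_u P u)%N.
Proof. by rewrite -sum1dep_card big_mkcond; apply: eq_bigr => u _; case: (P u). Qed.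

Lemma lvlE st j u : inA j (st u) -> st u = InA j.
Proof. by case: (st u) => //= i /eqP ->. Qed.

Definition moved st N k : nat := #|N :&: lev st k|.

(** Departures are added on the left instead of subtracted on the right, so that the identity holds
    in [nat]; it is checked vertex by vertex on indicators. *)
Lemma cnt_stepN st v N k : st v = Unexpl -> N \subset Aset st ->
  (cnt (stepN K v st N) k + accepts st N * moved st N k =
   cnt st k + accepts st N *
     ((#|N| == k) + (if k is k'.+1 then moved st N k' else 0)))%N.
Proof.
move=> sv NA.
have vN : v \notin N by apply/negP => /(subsetP NA); rewrite inE sv.
have mE j : moved st N j = (\sum_u ((u \in N) && inA j (st u)))%N.
  by rewrite -cardset_sum; apply: eq_card => u; rewrite !inE.
have vE : (#|N| == k) = (\sum_u ((u == v) && (#|N| == k)))%N :> nat.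
  rewrite (bigD1 v)//= eqxx big1 ?addn0// => u /negbTE ->; by [].
have pE : (if k is k'.+1 then moved st N k' else 0)%N =
    (\sum_u ((u \in N) && (if k is k'.+1 then inA k' (st u) else false)))%N.
  by case: (k) => [|k'] /=; [rewrite big1// => u _; rewrite andbF|exact: mE].
rewrite pE mE {1}vE /cnt /lev !cardset_sum /stepN -/(accepts st N).
case: (accepts st N); rewrite ?mul0n ?mul1n ?addn0; last first.
  by apply: eq_bigr => u _; case: eqP => // ->; rewrite sv.
rewrite -!big_split /=; apply: eq_bigr => u _.
case: eqP => [->|_] /=; first by rewrite sv (negbTE vN) /= eq_sym addn0.
case: (boolP (u \in N)) => uN /=; rewrite ?add0n ?addn0//.
have := subsetP NA u uN; rewrite inE; case: (st u) => //= j _.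
by rewrite addnC; congr (_ + _)%N; case: (k).
Qed.

Variables (R : realType) (p : R).

(* At the top level [k = K.-1] the departure term vanishes: an accepted [N]
   contains no vertex of that level. *)
Definition drift st N k : R :=
  (accepts st N)%:R * ((#|N| == k)%:R +
     (if k is k'.+1 then (moved st N k')%:R else 0) - (moved st N k)%:R).

Lemma cnt_stepN_drift st v N k : st v = Unexpl -> N \subset Aset st ->
  (cnt (stepN K v st N) k)%:R = (cnt st k)%:R + drift st N k.
Proof.
move=> sv NA; have /(congr1 (GRing.natmul (1 : R))) := cnt_stepN k sv NA.
rewrite !natrD !natrM !natrD /drift => e.
rewrite mulrBr addrA -[X in _ + X - _](_ :
  (accepts st N)%:R * ((#|N| == k)%:R + (if k is k'.+1 then moved st N k' else 0%N)%:R) = _).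
  by rewrite -e addrK.
by case: (k).
Qed.

Lemma moved_le st N k : (moved st N k <= #|N|)%N.
Proof. exact: subset_leq_card (subsetIl _ _). Qed.

Lemma drift_le st N k : `|drift st N k| <= K%:R.
Proof.
rewrite /drift; case: (boolP (accepts st N)) => [/andP[NK _]|_]; last first.
  by rewrite mul0r normr0.
rewrite mul1r; set x := (if k is _.+1 then _ else _).
have x01 : 0 <= x <= (#|N|)%:R.
  rewrite /x; case: (k) => [|k']; first by rewrite lexx ler0n.
  by rewrite ler0n ler_nat moved_le.
have m01 : 0 <= ((moved st N k)%:R : R) <= (#|N|)%:R by rewrite ler0n ler_nat moved_le.
have : (#|N|)%:R + 1 <= K%:R :> R by rewrite natr1 ler_nat.
have : 0 <= ((#|N| == k)%:R : R) <= 1 by rewrite ler0n lern1 leq_b1.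
by move: x01 m01; rewrite ler_norml; lra.
Qed.

(** The active vertices that can still receive a neighbour. Divided by n, their number is [aK2] of
    the densities. *)
Definition Alow st : {set 'I_n} := Aset st :\: lev st K.-1.

Lemma accepts_subset st N : N \subset Aset st ->
  accepts st N = (N \subset Alow st) && (#|N| < K)%N.
Proof.
move=> NA; rewrite /accepts andbC; congr (_ && _).
apply/forallP/subsetP => [H u uN|H u].
  have := H u; rewrite uN /= => lu; have := subsetP NA u uN.
  by rewrite !inE => uA; rewrite uA andbT; apply: contra lu => /lvlE ->.
apply/implyP => /H; rewrite !inE; case: (st u) => //= j.
by rewrite andbT.
Qed.

Hypothesis K0 : (0 < K)%N.

(** An accepted N is chosen inside [Alow], but all other active vertices, those of the top level
    included, must be non-neighbours; hence the binomial coefficient involves [Alow] and the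
    exponent [Aset]. *)
Lemma bern_accepts_card st k : (k < K)%N ->
  bern p (Aset st) (fun N => (accepts st N)%:R * (#|N| == k)%:R) =
  'C(#|Alow st|, k)%:R * (p ^+ k * (1 - p) ^+ (#|Aset st| - k)).
Proof.
move=> kK; rewrite -(sum_subsets_card_eq _
  (fun k => p ^+ k * (1 - p) ^+ (#|Aset st| - k))) /bern.
rewrite [RHS]big_mkcond [LHS]big_mkcond; apply: eq_bigr => N _.
case: (boolP (N \subset Aset st)) => NA; last first.
  rewrite ifF//; apply/negP => /andP[NL _]; case/negP: NA.
  exact: subset_trans NL (subsetDl _ _).
rewrite accepts_subset//; case: (boolP (N \subset Alow st)) => NL /=; last by rewrite mul0r mulr0.
by case: eqP => [->|_]; rewrite ?kK ?mulr0// !mulr1.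
Qed.

(** Removing u from N leaves a subset of [Alow] without u that has fewer than K - 1 elements; the
    edge to u contributes the factor p. *)
Lemma bern_accepts_mem st u : u \in Alow st ->
  bern p (Aset st) (fun N => (accepts st N)%:R * (u \in N)%:R) =
  p * \sum_(r < K.-1) 'C(#|Alow st|.-1, r)%:R *
         (p ^+ r * (1 - p) ^+ (#|Aset st|.-1 - r)).
Proof.
move=> uL; have uA : u \in Aset st by move: uL; rewrite inE => /andP[].
have LA : Alow st \subset Aset st by exact: subsetDl.
have -> : #|Alow st|.-1 = #|Alow st :\ u| by rewrite (cardsD1 u (Alow st)) uL.
rewrite -(sum_subsets_card_lt _
  (fun r => p ^+ r * (1 - p) ^+ (#|Aset st|.-1 - r))) big_distrr /=.
transitivity (\sum_(N : {set 'I_n} | [&& N \subset Alow st, (#|N| < K)%N & u \in N])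
    p ^+ #|N| * (1 - p) ^+ (#|Aset st| - #|N|)).
  rewrite /bern [RHS]big_mkcond [LHS]big_mkcond; apply: eq_bigr => N _.
  case: (boolP (N \subset Aset st)) => NA; last first.
    rewrite ifF//; apply/negP => /andP[NL _]; case/negP: NA.
    exact: subset_trans NL LA.
  rewrite accepts_subset//; case: (boolP (N \subset Alow st)) => NL /=; last by rewrite mul0r mulr0.
  by case: (#|N| < K)%N; case: (u \in N); rewrite ?mulr1 ?mul0r ?mulr0.
rewrite (reindex_onto (fun N => u |: N) (fun N => N :\ u)) /=; last first.
  by move=> N /and3P[_ _ uN]; rewrite setD1K.
apply: eq_big => [N|N].
  rewrite setU11 andbT subUset sub1set uL /=.
  case: (boolP (u \in N)) => uN.
    rewrite (_ : (_ :\ u == N) = false) ?andbF.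
      by rewrite subsetD1 uN andbF.
    by apply/negP => /eqP eN; rewrite -eN !inE eqxx in uN.
  rewrite setU1K// eqxx andbT subsetD1 uN andbT cardsU1 uN /= add1n.
  by congr (_ && _); lia.
move=> /andP[_ /eqP eN]; have uN : u \notin N by rewrite -eN !inE eqxx.
rewrite cardsU1 uN add1n exprS -mulrA; congr (p * (_ * (1 - p) ^+ _)).
by rewrite subnS predn_sub.
Qed.

(** Linearity of the mean over the vertices of level j, all of which lie in [Alow] because j is
    below the top level. *)
Lemma bern_accepts_moved st j : (j < K.-1)%N ->
  bern p (Aset st) (fun N => (accepts st N)%:R * (moved st N j)%:R) =
  (cnt st j)%:R * (p * \sum_(r < K.-1) 'C(#|Alow st|.-1, r)%:R *
         (p ^+ r * (1 - p) ^+ (#|Aset st|.-1 - r))).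
Proof.
move=> jK.
transitivity (\sum_(u in lev st j)
    bern p (Aset st) (fun N => (accepts st N)%:R * (u \in N)%:R)).
  rewrite -bern_sum; apply: eq_bern => N NA; rewrite -big_distrr /=; congr (_ * _).
  rewrite /moved -sum1_card natr_sum big_mkcond [RHS]big_mkcond /=.
  by apply: eq_bigr => u _; rewrite inE; case: (u \in N); case: (u \in lev st j).
rewrite (eq_bigr (fun=> p * \sum_(r < K.-1) 'C(#|Alow st|.-1, r)%:R *
         (p ^+ r * (1 - p) ^+ (#|Aset st|.-1 - r)))).
  by rewrite sumr_const mulr_natl.
move=> u uj; apply: bern_accepts_mem; move: uj; rewrite !inE => /lvlE -> /=.
by rewrite andbT neq_ltn jK.
Qed.

Lemma bern_accepts_moved_top st :
  bern p (Aset st) (fun N => (accepts st N)%:R * (moved st N K.-1)%:R) = 0.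
Proof.
rewrite /bern big1// => N NA; rewrite accepts_subset//.
case: (boolP (N \subset Alow st)) => NL /=; last by rewrite mul0r mulr0.
rewrite (_ : moved _ _ _ = 0%N) ?mulr0//; apply/eqP; rewrite cards_eq0.
apply/eqP/setP => u; rewrite !inE; apply/negP => /andP[/(subsetP NL)].
by rewrite !inE => /andP[/negbTE ->].
Qed.

Lemma bern_drift st k : bern p (Aset st) (fun N => drift st N k) =
  bern p (Aset st) (fun N => (accepts st N)%:R * (#|N| == k)%:R)
  + (if k is k'.+1 then bern p (Aset st) (fun N => (accepts st N)%:R * (moved st N k')%:R) else 0)
  - bern p (Aset st) (fun N => (accepts st N)%:R * (moved st N k)%:R).
Proof.
rewrite -[X in _ = _ + X]mulN1r -bern_scale.
by case: k => [|k]; rewrite ?addr0 -!bern_add; apply: eq_bern => N _; rewrite /drift; ring.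
Qed.

Lemma card_levels st m : (#|[set u | inAany (st u) && (lvl (st u) < m)%N]| =
  \sum_(j < m) cnt st j)%N.
Proof.
rewrite cardset_sum /cnt /lev.
under [RHS]eq_bigr do rewrite cardset_sum.
rewrite exchange_big /=; apply: eq_bigr => u _.
case: (st u) => [|j|] /=; [by rewrite big1| |by rewrite big1].
have [jm|mj] := ltnP j m; last first.
  by rewrite big1// => i _; apply/eqP; rewrite eqb0 neq_ltn (leq_trans (ltn_ord i) mj) orbT.
rewrite (bigD1 (Ordinal jm))//= eqxx big1// => i /eqP ij.
by apply/eqP; rewrite eqb0; apply/eqP => e; apply: ij; apply: val_inj.
Qed.

End Counts.

(** * Comparison of the mean increment with the field *)

Section Drift.
Import mathcomp.boot.fintype mathcomp.boot.finset.
Variables (R : realType) (K : nat) (c : R).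
Hypotheses (c0 : 0 < c) (K0 : (0 < K)%N).

Definition density n (st : 'I_n -> vstat) (k : 'I_K) : R := (cnt st k)%:R / n%:R.

Lemma aget_density n (st : 'I_n -> vstat) j : (j < K)%N ->
  aget (density st) j = (cnt st j)%:R / n%:R.
Proof. by move=> jK; rewrite /aget insubT. Qed.

Lemma asum_lt_density n (st : 'I_n -> vstat) m : (m <= K)%N ->
  asum_lt (density st) m =
  #|[set u | inAany (st u) && (lvl (st u) < m)%N]|%:R / n%:R.
Proof.
move=> mK; rewrite card_levels natr_sum big_distrl /=.
by apply: eq_bigr => j _; rewrite aget_density// (leq_trans (ltn_ord j)).
Qed.

Section State.
Variables (n : nat) (st : 'I_n -> vstat).
Hypothesis lvlK : forall u, (lvl (st u) < K)%N.

Lemma Aset_lvl : Aset st = [set u | inAany (st u) && (lvl (st u) < K)%N].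
Proof. by apply/setP => u; rewrite !inE lvlK andbT. Qed.

Lemma Alow_lvl : Alow K st = [set u | inAany (st u) && (lvl (st u) < K.-1)%N].
Proof.
apply/setP => u; rewrite !inE; have := lvlK u; case: (st u) => //= j.
by rewrite andbT; lia.
Qed.

Lemma aK1_density : aK1 (density st) = #|Aset st|%:R / n%:R.
Proof. by rewrite /aK1 asum_lt_density// Aset_lvl. Qed.

Lemma aK2_density : aK2 (density st) = #|Alow K st|%:R / n%:R.
Proof. by rewrite /aK2 asum_lt_density ?leq_pred// Alow_lvl. Qed.

Lemma density_itv k : 0 <= density st k <= 1.
Proof.
rewrite /density divr_ge0//=; case: (posnP n) => [n0|n0].
  by rewrite {2}n0 invr0 mulr0.
rewrite ler_pdivrMr ?ltr0n// mul1r ler_nat.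
by rewrite (leq_trans (max_card _))// card_ord.
Qed.

End State.

(** In the limit, [born_rate] is the probability that the new vertex enters level k, and [move_rate]
    the mean number of vertices passing from level j to level j + 1 in one step. *)
Definition born_rate (x : 'I_K -> R) k := Efac c x * (c ^+ k * aK2 x ^+ k / k`!%:R).
Definition move_rate (x : 'I_K -> R) j := c * aget x j * Efac c x * Sfun c x.

Lemma deltaE (x : 'I_K -> R) k : (k < K)%N -> delta c x k =
  born_rate x k + (if k is k'.+1 then move_rate x k' else 0)
    - (if k == K.-1 then 0 else move_rate x k).
Proof.
move=> kK; rewrite /delta /born_rate /move_rate.
case: k kK => [|k] kK /=.
  rewrite fact0 !expr0 mulr1 divr1 mulr1 addr0.
  (* For K = 1 the level 0 is also the top level; the departure term of [delta] vanishes there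
     because S is an empty sum. *)
  case: eqP => [e|_]; last by ring.
  by rewrite /Sfun -e big_ord0; ring.
case: eqP => [<-|_] /=; ring.
Qed.

Lemma drift_approx : exists2 C : R, 0 <= C & forall n (st : 'I_n -> vstat) (k : 'I_K),
  (0 < n)%N -> c <= n%:R -> (forall u, (lvl (st u) < K)%N) ->
  `|bern (c / n%:R) (Aset st) (fun N => drift K R st N k) - delta c (density st) k|
    <= C / n%:R.
Proof.
have H (r : 'I_K) : {C : R | 0 <= C & forall n m m' L M : nat,
  (0 < n)%N -> c <= n%:R -> (m <= m' <= m.+1)%N -> (m' <= n)%N ->
  (L <= M <= n)%N -> (M <= L + r.+1)%N ->
  `|'C(m, r)%:R * (c / n%:R) ^+ r * (1 - c / n%:R) ^+ L
     - expR (- (c * (M%:R / n%:R))) * (c ^+ r * (m'%:R / n%:R) ^+ r / r`!%:R)|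
  <= C / n%:R}.
  by apply: cid2; exact: poisson_approx.
pose C := \sum_r s2val (H r).
have C0 : 0 <= C by apply: sumr_ge0 => r _; exact: (s2valP (H r)).
have leC r : s2val (H r) <= C.
  by rewrite /C (bigD1 r)//= lerDl sumr_ge0// => i _; exact: (s2valP (H i)).
have HC n m m' L M r : (r < K)%N -> (0 < n)%N -> c <= n%:R -> (m <= m' <= m.+1)%N ->
    (m' <= n)%N -> (L <= M <= n)%N -> (M <= L + r.+1)%N ->
  `|'C(m, r)%:R * (c / n%:R) ^+ r * (1 - c / n%:R) ^+ L
     - expR (- (c * (M%:R / n%:R))) * (c ^+ r * (m'%:R / n%:R) ^+ r / r`!%:R)|
  <= C / n%:R.
  move=> rK n0 cn h1 h2 h3 h4.
  apply: le_trans (s2valP' (H (Ordinal rK)) n m m' L M n0 cn h1 h2 h3 h4) _.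
  by rewrite ler_pM2r ?invr_gt0 ?ltr0n.
(* The error of a move rate: c times a density, at most 1, times fewer than K Poisson terms, each
   off by C/n. *)
pose D := c * (K%:R * C).
have D0 : 0 <= D by rewrite !mulr_ge0// ltW.
exists (C + D + D); first by rewrite !addr_ge0.
move=> n st k n0 cn lvlK.
have An : (#|Aset st| <= n)%N by rewrite (leq_trans (max_card _))// card_ord.
have LA : (#|Alow K st| <= #|Aset st|)%N by rewrite subset_leq_card// subsetDl.
have born j : (j < K)%N ->
  `|bern (c / n%:R) (Aset st) (fun N => (accepts K st N)%:R * (#|N| == j)%:R)
     - born_rate (density st) j| <= C / n%:R.
  move=> jK; rewrite bern_accepts_card// mulrA /born_rate /Efac aK1_density// aK2_density//.
  by apply: HC => //; lia.
have move j : (j < K.-1)%N ->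
  `|bern (c / n%:R) (Aset st) (fun N => (accepts K st N)%:R * (moved st N j)%:R)
     - move_rate (density st) j| <= D / n%:R.
  move=> jK; rewrite bern_accepts_moved// /move_rate /Efac aK1_density//.
  rewrite aget_density; last by lia.
  have [->|cj] := posnP (cnt st j).
    by rewrite !mul0r mulr0 !mul0r subrr normr0 divr_ge0.
  have Lpos : (0 < #|Alow K st|)%N.
    apply: leq_trans cj _; apply/subset_leq_card/subsetP => u.
    by rewrite !inE => /lvlE -> /=; rewrite andbT; lia.
  set e := expR _; rewrite (_ : _ - _ = c * ((cnt st j)%:R / n%:R) *
    (\sum_(r < K.-1) 'C(#|Alow K st|.-1, r)%:R *
         ((c / n%:R) ^+ r * (1 - c / n%:R) ^+ (#|Aset st|.-1 - r))
     - e * Sfun c (density st))); last by ring.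
  have y01 : 0 <= ((cnt st j)%:R / n%:R : R) <= 1.
    have jK' : (j < K)%N by lia.
    exact: (density_itv st (Ordinal jK')).
  have /andP[y0 y1] := y01.
  rewrite normrM normrM (ger0_norm (ltW c0)) (ger0_norm y0).
  apply: (@le_trans _ _ (c * 1 * (K%:R * (C / n%:R)))); last by rewrite /D mulr1 !mulrA.
  apply: ler_pM; rewrite ?mulr_ge0 ?(ltW c0)//; first by rewrite ler_pM2l.
  rewrite /Sfun big_distrr /= -sumrB.
  apply: (@le_trans _ _ (\sum_(r < K.-1) C / n%:R)).
    apply: le_trans (ler_norm_sum _ _ _) _; apply: ler_sum => r _.
    rewrite mulrA aK2_density// {}/e; have := ltn_ord r.
    move: (nat_of_ord r) (#|Aset st|) (#|Alow K st|) An LA Lpos => r' A L An LA Lpos rK.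
    (* The Poisson bound is taken with m = L - 1, m' = L, exponent A - 1 - r' and M = A, since one
       edge is conditioned to be present. *)
    by apply: HC => //; lia.
  rewrite sumr_const card_ord -[leLHS]mulr_natl ler_wpM2r ?divr_ge0// ler_nat.
  exact: leq_pred.
rewrite bern_drift deltaE//; set b := bern _ _ _; set b' := born_rate _ _.
have := born k (ltn_ord k); rewrite -/b -/b'.
set x := (if _ is _.+1 then _ else _); set x' := (if _ is _.+1 then move_rate _ _ else _).
set y := bern _ _ _; set y' := (if _ then _ else _).
have xx' : `|x - x'| <= D / n%:R.
  rewrite /x /x'; case: (nat_of_ord k) (ltn_ord k) => [|k'] k'K.
    by rewrite subrr normr0 divr_ge0.
  by apply: move; lia.
have yy' : `|y - y'| <= D / n%:R.
  rewrite /y /y'; case: eqP => [->|kK].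
    by rewrite bern_accepts_moved_top// subrr normr0 divr_ge0.
  by apply: move; have := ltn_ord k; lia.
move: xx' yy'; rewrite !ler_norml !mulrDl; lra.
Qed.

End Drift.

(** * Second moment estimate *)

Section SecondMoment.
Variables (R : realType) (K : nat) (c C : R) (a : R -> 'I_K -> R).
Notation mu := (@lebesgue_measure R).
Hypotheses (c0 : 0 < c) (K0 : (0 < K)%N) (C0 : 0 < C).
Hypothesis dL : forall x y (k : 'I_K),
  `|clamped_delta c x k - clamped_delta c y k| <= C * dist1 x y.
Hypothesis alip : path_lipschitz C a.
Hypothesis aE : forall t k, mu.-integrable `[0, t]%classic
    (EFin \o (fun s => clamped_delta c (a s) k)) /\
  a t k = Rintegral mu `[0, t]%classic (fun s => clamped_delta c (a s) k).

Definition dist2 (x y : 'I_K -> R) : R := \sum_k (x k - y k) ^+ 2.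

Lemma dist2_ge0 x y : 0 <= dist2 x y.
Proof. by apply: sumr_ge0 => k _; exact: sqr_ge0. Qed.

(** The Cauchy-Schwarz inequality, from 2 a b <= a^2 + b^2 applied to each product of the expanded
    square. *)
Lemma dist1_sqr x y : dist1 x y ^+ 2 <= K%:R * dist2 x y.
Proof.
rewrite expr2 /dist1 big_distrlr /=.
apply: (@le_trans _ _ (\sum_(i < K) \sum_(j < K)
   ((x i - y i) ^+ 2 / 2 + (x j - y j) ^+ 2 / 2))).
  apply: ler_sum => i _; apply: ler_sum => j _.
  rewrite -(real_normK (num_real (x i - y i))) -(real_normK (num_real (x j - y j))).
  by have := sqr_ge0 (`|x i - y i| - `|x j - y j|); rewrite sqrrB; lra.
have e i : \sum_j ((x i - y i) ^+ 2 / 2 + (x j - y j) ^+ 2 / 2)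
    = K%:R * ((x i - y i) ^+ 2 / 2) + dist2 x y / 2.
  by rewrite big_split /= sumr_const card_ord -[_ *+ K]mulr_natl -mulr_suml.
under eq_bigr do rewrite e.
rewrite big_split /= sumr_const card_ord -[_ *+ K]mulr_natl -mulr_sumr -mulr_suml.
rewrite -/(dist2 x y); lra.
Qed.

(** During a time 1/n each coordinate of the path moves by at most C/n, hence the field by at most C
    K C / n. *)
Lemma solution_increment n t k : (0 < n)%N ->
  `|a (t.+1%:R / n%:R) k - a (t%:R / n%:R) k - clamped_delta c (a (t%:R / n%:R)) k / n%:R|
    <= C * (K%:R * C) / n%:R / n%:R.
Proof.
move=> n0; have n0' : 0 < n%:R :> R by rewrite ltr0n.
have e1 : t.+1%:R / n%:R - t%:R / n%:R = n%:R^-1 :> R by rewrite -mulrBl -natr1 addrAC subrr add0r mul1r.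
have [ai e] := aE (t.+1%:R / n%:R) k; have [_ e'] := aE (t%:R / n%:R) k.
rewrite e {1}e'.
have := @Rintegral_increment R (fun s => clamped_delta c (a s) k) (t%:R / n%:R)
  (t.+1%:R / n%:R) (clamped_delta c (a (t%:R / n%:R)) k) (C * (K%:R * C) / n%:R).
rewrite e1; apply => //.
  by rewrite ler_pM2r ?invr_gt0// ler_nat.
move=> x /andP[tx xt]; apply: le_trans (dL _ _ _) _.
rewrite -!mulrA ler_pM2l//; apply: dist1_le_const => i.
apply: le_trans (alip _ _ _) _; rewrite ler_pM2l// ger0_norm ?subr_ge0//.
by rewrite -[leRHS]e1 lerD2r.
Qed.

(** The square is expanded around the current error: the cross term is controlled by the mean of the
    change [w] of the error, the quadratic term by the bound (K + C)/n on [w] itself. *)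
Lemma bern_step : exists2 D : R, 0 <= D & forall n (t : nat) (st : 'I_n -> vstat) v,
  (0 < n)%N -> c <= n%:R -> (forall u, (lvl (st u) < K)%N) -> st v = Unexpl ->
  bern (c / n%:R) (Aset st) (fun N =>
      dist2 (density R (stepN K v st N)) (a (t.+1%:R / n%:R))) <=
  (1 + D / n%:R) * dist2 (density R st) (a (t%:R / n%:R)) + D / n%:R ^+ 2.
Proof.
have [D2 D20 HD] := drift_approx c0 K0.
pose D3 := D2 + C * (K%:R * C).
have D30 : 0 <= D3 by rewrite addr_ge0// !mulr_ge0// ltW.
(* With d and q the distances [dist1] and [dist2], the first two summands come from the cross term
   through d^2 <= K q and 2 d <= 1 + d^2. The last one collects the contributions free of q. *)
pose D := 2 * C * K%:R + D3 * K%:R + (D3 + K%:R * (K%:R + C) ^+ 2).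
have C0' := ltW C0.
have B0 : 0 <= D3 + K%:R * (K%:R + C) ^+ 2 by rewrite addr_ge0// mulr_ge0// sqr_ge0.
have G0 : 0 <= 2 * C * K%:R + D3 * K%:R by rewrite addr_ge0// ?mulr_ge0.
exists D; first by rewrite addr_ge0.
move=> n t st v n0 cn lvlK sv; have n0' : 0 < n%:R :> R by rewrite ltr0n.
set x' := a (t.+1%:R / n%:R); set x := a (t%:R / n%:R); set y := density R st.
have p01 : 0 <= c / n%:R <= 1.
  by rewrite divr_ge0 ?(ltW c0)// ler_pdivrMr// mul1r.
pose w (N : {set 'I_n}) (k : 'I_K) := drift K R st N k / n%:R - (x' k - x k).
have wle N k : `|w N k| <= (K%:R + C) / n%:R.
  rewrite mulrDl (le_trans (ler_normB _ _))// lerD//.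
    by rewrite normrM normfV (ger0_norm (ltW n0')) ler_pM2r ?invr_gt0// drift_le.
  apply: le_trans (alip _ _ _) _.
  by rewrite -mulrBl -natr1 addrAC subrr add0r mul1r ger0_norm ?invr_ge0// ltW.
have split (N : {set 'I_n}) : N \subset Aset st -> dist2 (density R (stepN K v st N)) x' =
    dist2 y x + (\sum_k 2 * (y k - x k) * w N k + \sum_k w N k ^+ 2).
  move=> NA; rewrite /dist2 -!big_split /=; apply: eq_bigr => k _.
  by rewrite /w /y /density (cnt_stepN_drift K R k sv NA); ring.
rewrite (eq_bern _ split) 2!bern_add bern_cst.
have dist_ge0 : 0 <= dist1 y x := dist1_ge0 y x.
have mean k : `|bern (c / n%:R) (Aset st) (fun N => w N k)|
    <= D3 / n%:R ^+ 2 + C * dist1 y x / n%:R.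
  rewrite bern_add bern_cst.
  rewrite (_ : bern _ _ _ = bern (c / n%:R) (Aset st) (fun N => drift K R st N k) / n%:R); last first.
    by rewrite [RHS]mulrC -bern_scale; apply: eq_bern => N _; rewrite mulrC.
  have H1 := HD n st k n0 cn lvlK.
  have H2 := solution_increment t k n0; rewrite -/x -/x' in H2.
  (* The densities lie in [0,1], so at y the clamped field is the true one. *)
  have H3 := dL y x k; rewrite clamped_delta_id in H3; last by move=> i; exact: density_itv.
  have := HD n st k n0 cn lvlK; set b := bern _ _ _ => H4.
  rewrite (_ : b / n%:R - _ = (b - delta c y k) / n%:R
    + (delta c y k - clamped_delta c x k) / n%:R
    - (x' k - x k - clamped_delta c x k / n%:R)); last by ring.
  apply: le_trans (ler_normB _ _) _; apply: le_trans (lerD (ler_normD _ _) (lexx _)) _.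
  rewrite !normrM normfV (ger0_norm (ltW n0')).
  rewrite (_ : _ + _ = D2 / n%:R / n%:R + C * dist1 y x / n%:R + C * (K%:R * C) / n%:R / n%:R).
    rewrite lerD//.
    by rewrite lerD// ler_pM2r ?invr_gt0.
  by rewrite /D3; field; rewrite gt_eqF.
have cross : bern (c / n%:R) (Aset st) (fun N => \sum_k 2 * (y k - x k) * w N k)
    <= 2 * dist1 y x * (D3 / n%:R ^+ 2 + C * dist1 y x / n%:R).
  rewrite bern_sum {1}/dist1 mulr_sumr mulr_suml; apply: ler_sum => k _.
  rewrite bern_scale; apply: le_trans (ler_norm _) _.
  rewrite normrM normrM ger0_norm//.
  by rewrite -[leLHS]mulrA -[leRHS]mulrA ler_pM2l// ler_wpM2l.
have quad : bern (c / n%:R) (Aset st) (fun N => \sum_k w N k ^+ 2)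
    <= K%:R * (K%:R + C) ^+ 2 / n%:R ^+ 2.
  rewrite -[leRHS](bern_cst (c / n%:R) (Aset st)); apply: bern_le => // N _.
  apply: (@le_trans _ _ (\sum_(k < K) ((K%:R + C) / n%:R) ^+ 2)).
    apply: ler_sum => k _; rewrite -(real_normK (num_real (w N k))).
    by rewrite lerXn2r ?nnegrE ?divr_ge0 ?addr_ge0// ltW.
  by rewrite sumr_const card_ord -[leLHS]mulr_natl expr_div_n mulrA.
have d12 := dist1_sqr y x.
have n1 : 1 <= n%:R :> R by rewrite ler1n.
set q := dist2 y x in d12 *; set d := dist1 y x in cross d12 mean dist_ge0 *.
have q0 : 0 <= q := dist2_ge0 y x.
have in0 : 0 < n%:R^-1 :> R by rewrite invr_gt0.
have in1 : n%:R^-1 <= 1 :> R by rewrite invf_le1.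
rewrite -exprVn in cross quad *; move: in0 in1 cross quad; set i := n%:R^-1 => in0 in1 cross quad.
have i0 := ltW in0.
have i2 : i ^+ 2 <= i by rewrite expr2 ler_piMr// ltW.
have s1 : C * d * i * (2 * d) <= 2 * C * K%:R * i * q.
  rewrite (_ : C * d * i * (2 * d) = 2 * C * i * d ^+ 2); last by ring.
  rewrite (_ : 2 * C * K%:R * i * q = 2 * C * i * (K%:R * q)); last by ring.
  by rewrite ler_wpM2l// !mulr_ge0// ltW.
have s2 : 2 * d * (D3 * i ^+ 2) <= D3 * i ^+ 2 + D3 * K%:R * i * q.
  apply: (@le_trans _ _ (D3 * i ^+ 2 + D3 * i ^+ 2 * (K%:R * q))).
    rewrite -[X in X + _]mulr1 -mulrDr [2 * d * _]mulrC ler_wpM2l ?mulr_ge0 ?sqr_ge0//.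
    by have := sqr_ge0 (d - 1); rewrite sqrrB1; lra.
  rewrite lerD2l (_ : D3 * K%:R * i * q = D3 * i * (K%:R * q)); last by ring.
  by rewrite ler_wpM2r ?mulr_ge0// ler_wpM2l.
have s3 : 0 <= (D3 + K%:R * (K%:R + C) ^+ 2) * i * q by rewrite !mulr_ge0// ltW.
have s4 : 0 <= (2 * C * K%:R + D3 * K%:R) * i ^+ 2 by rewrite mulr_ge0// sqr_ge0.
by rewrite /D; lra.
Qed.

(** A discrete Gronwall argument starting from error 0, with (1 + D/n)^n <= e^D. The selection order
    s is fixed and only the edges are random; the bound is uniform in s. *)
Lemma second_moment : exists2 D : R, 0 <= D & forall n (s : 'S_n) (t : nat),
  (0 < n)%N -> c <= n%:R -> (t <= n)%N ->
  bern (c / n%:R) (upper_pairs n) (fun E =>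
    dist2 (density R (explore K s E t)) (a (t%:R / n%:R))) <= D / n%:R.
Proof.
have [D D0 HD] := bern_step.
exists (D * expR D); first by rewrite mulr_ge0 ?expR_ge0.
move=> n s t n0 cn tn; have n0' : 0 < n%:R :> R by rewrite ltr0n.
have p01 : 0 <= c / n%:R <= 1.
  by rewrite divr_ge0 ?(ltW c0)// ler_pdivrMr// mul1r.
have Dn0 : 0 <= D / n%:R by rewrite divr_ge0// ltW.
have rec m : (m <= n)%N -> bern (c / n%:R) (upper_pairs n) (fun E =>
    dist2 (density R (explore K s E m)) (a (m%:R / n%:R)))
    <= m%:R * (D / n%:R ^+ 2) * (1 + D / n%:R) ^+ m.
  elim: m => [|m IH] mn.
    rewrite !mul0r le_eqVlt; apply/orP; left; apply/eqP.
    rewrite -[RHS](bern_cst (c / n%:R) (upper_pairs n)); apply: eq_bern => E _.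
    rewrite /dist2 big1// => k _; have [_ ->] := aE 0 k.
    rewrite set_itv1 Rintegral_set1 /density /cnt.
    rewrite (_ : #|_| = 0%N) ?mul0r ?subrr ?expr0n//.
    by apply: eq_card0 => u; rewrite inE.
  rewrite (@markov_step K n R (c / n%:R) s m mn (fun st => dist2 (density R st) (a (m.+1%:R / n%:R)))).
  apply: (@le_trans _ _ (bern (c / n%:R) (upper_pairs n) (fun E =>
    (1 + D / n%:R) * dist2 (density R (explore K s E m)) (a (m%:R / n%:R)) + D / n%:R ^+ 2))).
    apply: bern_le => // E _; apply: HD => //.
      by move=> u; exact: explore_lvl.
    by apply: explore_unseen; exact: last_notin_seen.
  rewrite bern_add bern_scale bern_cst -natr1 [(m%:R + 1) * _]mulrDl [(_ + _) * (_ ^+ _)]mulrDl lerD//.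
    rewrite [_ ^+ m.+1]exprS [leRHS]mulrCA ler_wpM2l ?IH ?(ltnW mn)//.
    by rewrite addr_ge0.
  rewrite mul1r ler_peMr ?divr_ge0 ?exprn_ge0 ?(ltW n0')//.
  by rewrite exprn_ege1// lerDl.
apply: le_trans (rec t tn) _.
apply: (@le_trans _ _ (n%:R * (D / n%:R ^+ 2) * expR (D / n%:R) ^+ n)).
  have h : 0 <= D / n%:R ^+ 2 by rewrite divr_ge0// exprn_ge0// ltW.
  apply: ler_pM; rewrite ?mulr_ge0// ?exprn_ge0 ?addr_ge0//.
    by rewrite ler_wpM2r// ler_nat.
  apply: (@le_trans _ _ ((1 + D / n%:R) ^+ n)).
    by rewrite ler_weXn2l// lerDl.
  by rewrite lerXn2r ?nnegrE ?expR_ge0 ?addr_ge0// expR_ge1Dx.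
rewrite -expRM_natr divfK ?gt_eqF// le_eqVlt; apply/orP; left; apply/eqP.
by field; rewrite gt_eqF.
Qed.

End SecondMoment.

(** * The threshold model and the limit theorem *)

Section ThresholdExploration.
Import mathcomp.boot.fintype mathcomp.boot.finset.
Variables (K n : nat) (s : 'S_n) (E : {set 'I_n * 'I_n}).
Hypothesis K0 : (0 < K)%N.

Lemma adjC u v : adj E u v = adj E v u.
Proof. by rewrite /adj eq_sym orbC. Qed.

Lemma adjvv u : adj E u u = false.
Proof. by rewrite /adj eqxx. Qed.

Definition nbrs (A : {set 'I_n}) u : {set 'I_n} := [set w in A | adj E u w].

Lemma card_nbrsU1 (A : {set 'I_n}) u v : v \notin A ->
  #|nbrs (v |: A) u| = (adj E u v + #|nbrs A u|)%N.
Proof.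
move=> vA; case: (boolP (adj E u v)) => uv.
  have -> : nbrs (v |: A) u = v |: nbrs A u.
    apply/setP => w; rewrite !inE; case: eqP => [->|//]; by rewrite uv.
  by rewrite cardsU1 !inE (negbTE vA).
have -> // : nbrs (v |: A) u = nbrs A u.
apply/setP => w; rewrite !inE; case: eqP => [->|//].
by rewrite (negbTE uv) !andbF.
Qed.

(** Both statements are carried through one induction: as levels are degrees, adding v keeps all
    degrees below K exactly when v has fewer than K active neighbours and none of them is at level K
    - 1. *)
Lemma threshold_explore m : threshold K s E m = Aset (explore K s E m) /\
  forall u, u \in Aset (explore K s E m) ->
    lvl (explore K s E m u) = #|nbrs (Aset (explore K s E m)) u|.
Proof.
elim: m => [|m [IH1 IH2]]; first by split=> [|u]; [apply/setP => u|]; rewrite !inE.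
have [mn|nm] := ltnP m n; last first.
  by rewrite /= /explore_step insubF//; rewrite ltnNge nm.
have defT : threshold K s E m.+1 = if maxdeg_lt K E (s (Ordinal mn) |: threshold K s E m)
    then s (Ordinal mn) |: threshold K s E m else threshold K s E m.
  by rewrite /= insubT.
rewrite {}defT IH1 (exploreS K s E mn).
set v := s (Ordinal mn); set st := explore K s E m in IH2 *; set A := Aset st in IH2 *.
have lK u : (lvl (st u) < K)%N by exact: explore_lvl.
have vA : v \notin A by rewrite inE /st explore_unseen// last_notin_seen.
have -> : [set u in A | adj E u v] = nbrs A v.
  by apply/setP => u; rewrite !inE adjC.
have nv : #|nbrs (v |: A) v| = #|nbrs A v| by rewrite card_nbrsU1// adjvv.
have -> : maxdeg_lt K E (v |: A) = (#|nbrs A v| < K)%N &&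
    [forall u in nbrs A v, lvl (st u) != K.-1].
  apply/forallP/andP => [H|[H1 /forallP H2] u].
    split; first by have := H v; rewrite setU11 -/(nbrs (v |: A) v) nv.
    apply/forallP => u; apply/implyP; rewrite inE => /andP[uA vu].
    have := H u; rewrite setU1r// -/(nbrs (v |: A) u) card_nbrsU1// adjC vu /= -IH2//.
    by move=> h; apply/eqP; lia.
  apply/implyP; rewrite inE -/(nbrs (v |: A) u) => /orP[|uA].
    by rewrite inE => /eqP ->; rewrite nv.
  rewrite card_nbrsU1// -IH2//; case: (boolP (adj E u v)) => uv /=; last exact: lK.
  have := H2 u; rewrite inE uA adjC uv /= => /eqP h; have := lK u; lia.
rewrite /stepN; case: ifP => acc; last first.
  have -> : Aset (fun u => if u == v then InB else st u) = A.
    by apply/setP => u; rewrite !inE; case: eqP => [->|//]; rewrite inE in vA; rewrite (negbTE vA).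
  split=> // u uA; rewrite -IH2//; case: eqP => // uv.
  by rewrite -uv uA in vA.
have -> : Aset (fun u => if u == v then InA #|nbrs A v|
    else if u \in nbrs A v then InA (lvl (st u)).+1 else st u) = v |: A.
  apply/setP => u; rewrite !inE; case: eqP => //= _.
  by case: (st u) => //= j; case: (adj E v u).
split=> // u; rewrite inE in_set1 card_nbrsU1//; case: eqP => [->|_] /=.
  by rewrite adjvv.
move=> uA; have -> : (u \in nbrs A v) = adj E u v by rewrite inE uA adjC.
by rewrite -IH2//; case: (adj E u v).
Qed.

Lemma card_final_active :
  #|final_active K s E| = (\sum_(k < K) cnt (explore K s E n) k)%N.
Proof.
rewrite /final_active; have [-> _] := threshold_explore n.
rewrite -card_levels; congr #|pred_of_set _|; apply/setP => u.
by rewrite !inE explore_lvl// andbT.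
Qed.

Lemma Acount_cnt k m : Acount K s E k m = cnt (explore K s E m) k.
Proof. by apply: eq_card => u; rewrite !inE; apply/asboolP/idP. Qed.

Lemma cnt_explore_lipschitz (R : realType) (k : nat) m j :
  `|(cnt (explore K s E (m + j)) k)%:R - (cnt (explore K s E m) k)%:R| <= K%:R * j%:R :> R.
Proof.
elim: j => [|j IH]; first by rewrite addn0 subrr normr0 mulr0.
rewrite addnS -[X in _ <= _ * X]natr1 mulrDr mulr1 [leRHS]addrC.
apply: le_trans (ler_distD (cnt (explore K s E (m + j)) k)%:R _ _) _; apply: lerD => //.
have [mn|nm] := ltnP (m + j) n; last first.
  rewrite /= /explore_step insubF; last by rewrite ltnNge nm.
  by rewrite subrr normr0.
rewrite (exploreS K s E mn) (@cnt_stepN_drift K n R).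
- by rewrite addrC addKr drift_le.
- by apply: explore_unseen; exact: last_notin_seen.
- by apply/subsetP => u; rewrite inE => /andP[].
Qed.

End ThresholdExploration.

(** * Averaging over the selection order *)

Section Expectation.
Import mathcomp.boot.fintype mathcomp.boot.finset.
Variables (R : realType) (n : nat) (p : R).

Lemma ExpE (X : 'S_n -> {set 'I_n * 'I_n} -> R) :
  Exp p X = (n`!)%:R^-1 * \sum_s bern p (upper_pairs n) (X s).
Proof.
rewrite /Exp mulr_sumr; apply: eq_bigr => s _.
rewrite /bern mulr_sumr [RHS]big_mkcond; apply: eq_bigr => E _.
by rewrite /weight; case: ifP => _; rewrite ?mul0r// !mulrA.
Qed.

Lemma Exp_le_const (X : 'S_n -> {set 'I_n * 'I_n} -> R) (r : R) :
  (forall s, bern p (upper_pairs n) (X s) <= r) -> Exp p X <= r.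
Proof.
move=> Xr; rewrite ExpE ler_pdivrMl ?ltr0n ?fact_gt0//.
apply: le_trans (ler_sum _ (fun s _ => Xr s)) _.
by rewrite sumr_const card_Sn mulr_natl.
Qed.

Lemma Exp_dist (X : 'S_n -> {set 'I_n * 'I_n} -> R) (L r : R) : 0 <= p <= 1 ->
  (forall s, bern p (upper_pairs n) (fun E => `|L - X s E|) <= r) ->
  `|L - Exp p X| <= r.
Proof.
move=> p01 Xr.
have -> : L - Exp p X = Exp p (fun s E => L - X s E).
  rewrite !ExpE [RHS](_ : _ = (n`!)%:R^-1 * \sum_(s : 'S_n) (L + -1 * bern p (upper_pairs n) (X s))).
    rewrite big_split /= sumr_const card_Sn -mulr_sumr mulN1r mulrBr -[L *+ _]mulr_natl.
    by rewrite mulrA mulVf ?mul1r// pnatr_eq0 -lt0n fact_gt0.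
  congr (_ * _); apply: eq_bigr => s _; rewrite -bern_scale -[X in _ = X + _](bern_cst p (upper_pairs n)).
  by rewrite -bern_add; apply: eq_bern => E _; rewrite mulN1r.
rewrite ler_norml; apply/andP; split; last first.
  apply: Exp_le_const => s; apply: le_trans (Xr s); apply: bern_le => // E _.
  exact: ler_norm.
rewrite lerNl.
have -> : - Exp p (fun s E => L - X s E) = Exp p (fun s E => - (L - X s E)).
  rewrite !ExpE -mulrN -sumrN; congr (_ * _); apply: eq_bigr => s _.
  by rewrite -mulN1r -bern_scale; apply: eq_bern => E _; rewrite mulN1r.
apply: Exp_le_const => s; apply: le_trans (Xr s); apply: bern_le => // E _.
by rewrite -normrN ler_norm.
Qed.

End Expectation.

(** * Confinement to [0,1] and convergence *)

Section Limit.
Import mathcomp.boot.fintype mathcomp.boot.finset.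
Variables (R : realType) (K : nat) (c C : R) (a : R -> 'I_K -> R).
Notation mu := (@lebesgue_measure R).
Hypotheses (c0 : 0 < c) (K0 : (0 < K)%N) (C0 : 0 < C).
Hypothesis dL : forall x y (k : 'I_K),
  `|clamped_delta c x k - clamped_delta c y k| <= C * dist1 x y.
Hypothesis alip : path_lipschitz C a.
Hypothesis aE : forall t k, mu.-integrable `[0, t]%classic
    (EFin \o (fun s => clamped_delta c (a s) k)) /\
  a t k = Rintegral mu `[0, t]%classic (fun s => clamped_delta c (a s) k).

Lemma dist2_ge (x y : 'I_K -> R) k : (x k - y k) ^+ 2 <= dist2 x y.
Proof. by rewrite /dist2 (bigD1 k)//= lerDl sumr_ge0// => i _; exact: sqr_ge0. Qed.

Lemma lipschitz_truncn n t k : (0 < n)%N -> 0 <= t ->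
  `|a ((Num.truncn (n%:R * t))%:R / n%:R) k - a t k| <= C / n%:R.
Proof.
move=> n0 t0; have n0' : 0 < n%:R :> R by rewrite ltr0n.
have /andP[t1 t2] := truncn_itv (mulr_ge0 (ltW n0') t0).
apply: le_trans (alip _ _ _) _; rewrite ler_pM2l// distrC ger0_norm.
  have : t <= (Num.truncn (n%:R * t)).+1%:R / n%:R by rewrite ler_pdivlMr// mulrC ltW.
  by rewrite -natr1 mulrDl mul1r; lra.
by rewrite subr_ge0 ler_pdivrMr// [t * _]mulrC.
Qed.

Lemma truncn_le_n n (t : R) : 0 <= t <= 1 -> (Num.truncn (n%:R * t) <= n)%N.
Proof.
move=> /andP[t0 t1]; rewrite -[leqRHS](natrK (R := R)) le_truncn//.
by rewrite ler_piMr.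
Qed.

(* The distance of a_k(t) to [0,1] is at most |A_k(t)/n - a_k(t)| for every n. *)
Lemma solution_itv t k : 0 <= t <= 1 -> 0 <= a t k <= 1.
Proof.
move=> t01; have /andP[t0 t1] := t01.
suff : clamp01 (a t k) = a t k by move=> <-; exact: clamp01_itv.
apply/eqP; rewrite -subr_eq0 -normr_le0 leNgt; apply/negP.
set e := `|_| => e0.
have [D D0 HD] := second_moment c0 K0 C0 dL alip aE.
(* n > Q ensures c <= n, C/n <= e/4 and D/n < (e/2)^2. *)
pose Q := c + 4 * C / e + 4 * D / e ^+ 2.
have q1 : 0 <= 4 * C / e by rewrite divr_ge0 ?mulr_ge0// ltW.
have q2 : 0 <= 4 * D / e ^+ 2 by rewrite divr_ge0 ?mulr_ge0 ?exprn_ge0// ltW.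
pose n := (Num.bound `|Q|).+1.
have nQ : Q < n%:R.
  rewrite (le_lt_trans (ler_norm _))// (lt_trans (archi_boundP _))//.
  by rewrite ltr_nat.
have n0' : 0 < n%:R :> R by rewrite ltr0n.
have cn : c <= n%:R by move: nQ; rewrite /Q; lra.
have Q1 : 4 * C / e <= n%:R by move: nQ; rewrite /Q; have := ltW c0; lra.
have Q2 : 4 * D / e ^+ 2 < n%:R by move: nQ; rewrite /Q; have := ltW c0; lra.
pose m := Num.truncn (n%:R * t).
(* The estimate holds for every selection order; the identity is chosen. *)
have := HD n 1%g m (ltn0Sn _) cn (truncn_le_n n t01).
have p01 : 0 <= c / n%:R <= 1.
  by rewrite divr_ge0 ?(ltW c0)// ler_pdivrMr// mul1r.
apply/negP; rewrite -ltNge.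
pose x := a (m%:R / n%:R) k.
apply: (@lt_le_trans _ _ ((clamp01 x - x) ^+ 2)); last first.
  rewrite -[leLHS](bern_cst (c / n%:R) (upper_pairs n)).
  apply: bern_le => // E _; apply: le_trans (dist2_ge _ _ k).
  set y := density R _ k; have y01 : 0 <= y <= 1 by exact: density_itv.
  rewrite -(real_normK (num_real (clamp01 x - x))) -(real_normK (num_real (y - _))).
  rewrite lerXn2r ?nnegrE// -/x; move: y01; rewrite /clamp01 !(maxElt, minElt).
  move=> /andP[y0 y1]; case: (ltP x 1) => x1; case: ltP => x0.
  - by rewrite subrr normr0.
  - by rewrite sub0r (ger0_norm (x := - x)) ?ger0_norm; lra.
  - by rewrite distrC (distrC y) !ger0_norm; lra.
  - by lra.
have l1 := lipschitz_truncn k (ltn0Sn _ : (0 < n)%N) t0; rewrite -/m -/x in l1.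
have l2 : `|clamp01 x - clamp01 (a t k)| <= C / n%:R.
  exact: le_trans (clamp01_dist _ _) l1.
have Cn : C / n%:R <= e / 4.
  by move: Q1; rewrite !ler_pdivrMr//; lra.
(* Passing from t to the grid point m/n changes both the path and its clamped value by at most
   e/4. *)
have ex : e / 2 <= `|clamp01 x - x|.
  have : e <= `|clamp01 (a t k) - clamp01 x| + (`|clamp01 x - x| + `|x - a t k|).
    rewrite /e; apply: le_trans (ler_distD (clamp01 x) _ _) _.
    by rewrite lerD2l ler_distD.
  by rewrite (distrC (clamp01 (a t k))); lra.
rewrite -(real_normK (num_real (clamp01 x - x))).
apply: (@lt_le_trans _ _ ((e / 2) ^+ 2)); last first.
  by rewrite lerXn2r ?nnegrE// divr_ge0// ltW.
rewrite ltr_pdivrMr// expr_div_n mulrAC ltr_pdivlMr ?exprn_gt0// mulrC.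
rewrite -ltr_pdivrMl ?exprn_gt0// mulrC.
by rewrite (_ : _ * _ = 4 * D / e ^+ 2)//; ring.
Qed.

Lemma clamped_is_solution : is_solution c a.
Proof.
move=> k t t01; have [ai e] := aE t k.
have eq (s : R) : s \in `[0, t]%classic -> clamped_delta c (a s) k = delta c (a s) k.
  move=> /set_mem /=; rewrite in_itv /= => /andP[s0 st]; apply: clamped_delta_id => i.
  by apply: solution_itv; rewrite s0 (le_trans st)//; case/andP: t01.
split.
  by apply: eq_integrable ai => // s st /=; rewrite eq.
by rewrite e; apply: eq_Rintegral => s st; exact: eq.
Qed.

Definition far n (s : 'S_n) (E : {set 'I_n * 'I_n}) (d : R) : bool :=
  [exists t : 'I_n.+1, exists k : 'I_K,
    d < `|density R (explore K s E t) k - a (t%:R / n%:R) k|].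

(* If the two paths are d apart at time t, they are still d / 2 apart at the
   last multiple of w before t. *)
Lemma far_le_grid n s E d w : (0 < n)%N -> (0 < w)%N -> 0 < d ->
  (K%:R + C) * w%:R / n%:R <= d / 2 ->
  (@far n s E d)%:R <= \sum_(i < (n %/ w).+1)
     4 / d ^+ 2 * dist2 (density R (explore K s E (i * w))) (a ((i * w)%:R / n%:R)).
Proof.
move=> n0 w0 d0 wd; have n0' : 0 < n%:R :> R by rewrite ltr0n.
have d20 : 0 < d ^+ 2 by rewrite exprn_gt0.
case: (boolP (far s E d)) => [|_]; last first.
  by apply: sumr_ge0 => i _; rewrite mulr_ge0 ?dist2_ge0// divr_ge0// ltW.
move=> /existsP[t /existsP[k dt]].
have tw : (t %/ w < (n %/ w).+1)%N by rewrite ltnS leq_div2r// -ltnS.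
rewrite (bigD1 (Ordinal tw))//= ler_wpDr//.
  by apply: sumr_ge0 => i _; rewrite mulr_ge0 ?dist2_ge0// divr_ge0// ltW.
rewrite mulrAC ler_pdivlMr// mul1r.
set m := (t %/ w * w)%N.
have tE : nat_of_ord t = (m + t %% w)%N by rewrite /m -divn_eq.
have tmw : (t %% w)%:R <= w%:R :> R by rewrite ler_nat ltnW// ltn_pmod.
have h1 := cnt_explore_lipschitz K s E R k m (t %% w); rewrite -tE in h1.
have h2 : `|density R (explore K s E t) k - density R (explore K s E m) k| <= K%:R * w%:R / n%:R.
  rewrite /density -mulrBl normrM normfV (ger0_norm (ltW n0')) ler_pM2r ?invr_gt0//.
  by apply: le_trans h1 _; rewrite ler_wpM2l.
have h3 : `|a (t%:R / n%:R) k - a (m%:R / n%:R) k| <= C * w%:R / n%:R.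
  apply: le_trans (alip _ _ _) _; rewrite -mulrA ler_pM2l// -mulrBl.
  rewrite normrM normfV (ger0_norm (ltW n0')) ler_pM2r ?invr_gt0//.
  by rewrite {1}tE natrD addrC addKr ger0_norm.
have h4 : d / 2 <= `|density R (explore K s E m) k - a (m%:R / n%:R) k|.
  have := ler_distD (density R (explore K s E m) k) (density R (explore K s E t) k) (a (t%:R / n%:R) k).
  have := ler_distD (a (m%:R / n%:R) k) (density R (explore K s E m) k) (a (t%:R / n%:R) k).
  rewrite (distrC (a (m%:R / n%:R) k)); move: wd; rewrite !mulrDl; lra.
have := @dist2_ge (density R (explore K s E m)) (a (m%:R / n%:R)) k.
rewrite -(real_normK (num_real (density R _ k - _))) => h5.
have : (d / 2) ^+ 2 <= `|density R (explore K s E m) k - a (m%:R / n%:R) k| ^+ 2.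
  by rewrite lerXn2r ?nnegrE// divr_ge0// ltW.
rewrite expr_div_n (_ : 2 ^+ 2 = 4 :> R); last by rewrite -natrX.
lra.
Qed.

(** A union bound over the multiples of w. As w is proportional to n, their number stays bounded,
    while each contributes O(1/n) by the second moment estimate. *)
Lemma far_prob d e : 0 < d -> 0 < e -> exists N, forall n, (N <= n)%N ->
  [/\ (0 < n)%N, c <= n%:R, C / n%:R <= d &
   forall s : 'S_n, bern (c / n%:R) (upper_pairs n) (fun E => (far s E d)%:R) <= e].
Proof.
move=> d0 e0; have [D D0 HD] := second_moment c0 K0 C0 dL alip aE.
have d20 : 0 < d ^+ 2 by rewrite exprn_gt0.
(* Chosen so that (K + C) h = d/2: within a time h the two paths separate by at most d/2. *)
pose h := d / (2 * (K%:R + C)).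
have KC : 0 < K%:R + C by rewrite ltr_wpDl.
have h0 : 0 < h by rewrite divr_gt0// mulr_gt0.
pose B := (2 / h + 1) * (4 / d ^+ 2 * D).
have B0 : 0 <= B.
  apply: mulr_ge0; first by apply: addr_ge0 => //; rewrite divr_ge0// ltW.
  by apply: mulr_ge0 => //; rewrite divr_ge0// ltW.
pose Q := c + C / d + 2 / h + B / e.
have q1 : 0 <= C / d by rewrite divr_ge0// ltW.
have q2 : 0 <= 2 / h by rewrite divr_ge0// ltW.
have q3 : 0 <= B / e by rewrite divr_ge0// ltW.
exists (Num.bound `|Q|) => n Nn.
have nQ : Q < n%:R.
  rewrite (le_lt_trans (ler_norm _))// (lt_le_trans (archi_boundP _))//.
  by rewrite ler_nat.
have cn : c < n%:R by move: nQ; rewrite /Q; lra.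
have n0' : 0 < n%:R :> R by rewrite (lt_trans c0).
have n0 : (0 < n)%N by rewrite -(ltr0n R).
split => //; first exact: ltW.
  rewrite ler_pdivrMr// mulrC -ler_pdivrMr//.
  by move: nQ; rewrite /Q; have := ltW c0; lra.
move=> s.
have p01 : 0 <= c / n%:R <= 1.
  by rewrite divr_ge0 ?(ltW c0)// ler_pdivrMr// mul1r ltW.
pose w := Num.truncn (h * n%:R).
have /andP[w1 w2] := truncn_itv (mulr_ge0 (ltW h0) (ltW n0')); rewrite -/w in w1 w2.
(* This gives w > h n - 1 >= h n / 2, so that n / w <= 2 / h. *)
have hn : 2 <= h * n%:R.
  rewrite -ler_pdivrMl// mulrC; move: nQ; rewrite /Q; have := ltW c0; lra.
have w0 : (0 < w)%N.
  by rewrite -(ltr_nat R); move: w2; rewrite -natr1; lra.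
have w0' : 0 < w%:R :> R by rewrite ltr0n.
have wd : (K%:R + C) * w%:R / n%:R <= d / 2.
  rewrite ler_pdivrMr//; apply: le_trans (ler_wpM2l (ltW KC) w1) _.
  rewrite le_eqVlt; apply/orP; left; apply/eqP; rewrite /h; field.
  by rewrite gt_eqF.
apply: le_trans (bern_le p01 (fun E _ => far_le_grid s E n0 w0 d0 wd)) _.
rewrite bern_sum.
apply: (@le_trans _ _ (\sum_(i < (n %/ w).+1) 4 / d ^+ 2 * (D / n%:R))).
  apply: ler_sum => i _; rewrite bern_scale ler_wpM2l ?divr_ge0 ?(ltW d20)//.
  apply: HD => //; first exact: ltW.
  apply: leq_trans (leq_divM n w); rewrite leq_mul2r -ltnS ltn_ord orbT//.
rewrite sumr_const card_ord -[leLHS]mulr_natl.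
apply: (@le_trans _ _ ((2 / h + 1) * (4 / d ^+ 2 * (D / n%:R)))).
  have G0 : 0 <= 4 / d ^+ 2 * (D / n%:R).
    by apply: mulr_ge0; [rewrite divr_ge0// ltW|rewrite divr_ge0// ltW].
  rewrite ler_wpM2r//.
  rewrite -natr1 lerD2r ler_pdivlMr// mulrC.
  apply: (@le_trans _ _ ((n %/ w)%:R * (w%:R * 2) / n%:R)).
    rewrite ler_pdivlMr// mulrAC [h * _ * _]mulrC ler_wpM2l// .
    by move: w2; rewrite -natr1; lra.
  rewrite ler_pdivrMr// mulrA [2 * _]mulrC ler_wpM2r//.
  by rewrite -natrM ler_nat leq_divM.
have -> : (2 / h + 1) * (4 / d ^+ 2 * (D / n%:R)) = B / n%:R by rewrite /B; ring.
rewrite ler_pdivrMr// mulrC -ler_pdivrMr//.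
by move: nQ; rewrite /Q; have := ltW c0; lra.
Qed.

(** Off the event [far] the paths are uniformly within d/2 + C/n <= d, so F changes by less than
    e/2; on that event F changes by at most 2 M, and the event has small probability. *)
Lemma conv_path : conv_dist_path (fun n : nat => c / n%:R)
  (fun n s E => @alpha_n R K n s E) a.
Proof.
move=> F [[M FM] Fc]; apply/cvgrPdist_le => /= e e0.
have e20 : 0 < e / 2 by rewrite divr_gt0.
have [d d0 Fd] := Fc a _ e20.
have M0 : 0 <= M := le_trans (normr_ge0 _) (FM a).
have M1 : 0 < 2 * M + 1 by rewrite ltr_wpDl// mulr_ge0.
have d20 : 0 < d / 2 by rewrite divr_gt0.
have eM : 0 < e / 2 / (2 * M + 1) by rewrite divr_gt0.
have [N HN] := far_prob d20 eM.
exists N => // n /= /HN [n0 cn Cn Hfar].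
have n0' : 0 < n%:R :> R by rewrite ltr0n.
have p01 : 0 <= c / n%:R <= 1.
  by rewrite divr_ge0 ?(ltW c0)// ler_pdivrMr// mul1r.
apply: Exp_dist => // s.
apply: (@le_trans _ _ (bern (c / n%:R) (upper_pairs n)
   (fun E => e / 2 + 2 * M * (far s E (d / 2))%:R))).
  apply: bern_le => // E _; case: (boolP (far s E (d / 2))) => fE.
    rewrite mulr1; have := FM a; have := FM (@alpha_n R K n s E).
    by have := ler_normB (F a) (F (@alpha_n R K n s E)); lra.
  rewrite mulr0 addr0 distrC ltW// Fd// => t t01 k.
  have /andP[t0 t1] := t01; pose m := Num.truncn (n%:R * t).
  have mn : (m < n.+1)%N by rewrite ltnS truncn_le_n.
  rewrite /alpha_n Acount_cnt -/m.
  have : `|density R (explore K s E m) k - a (m%:R / n%:R) k| <= d / 2.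
    rewrite leNgt; apply: contra fE => h; apply/existsP; exists (Ordinal mn).
    by apply/existsP; exists k.
  have := lipschitz_truncn k n0 t0; rewrite -/m.
  have := ler_distD (a (m%:R / n%:R) k) (density R (explore K s E m) k) (a t k).
  rewrite /density; lra.
rewrite bern_add bern_cst bern_scale.
have : 2 * M * bern (c / n%:R) (upper_pairs n) (fun E => (far s E (d / 2))%:R) <= e / 2.
  apply: le_trans (ler_wpM2l _ (Hfar s)) _; first by rewrite mulr_ge0.
  rewrite mulrCA -[leRHS]mulr1 ler_pM2l// ler_pdivrMr// mul1r; lra.
lra.
Qed.

(** Summing the coordinates at time 1 and applying g is a bounded functional, continuous for uniform
    convergence; on [alpha_n] the sum is the final active density. *)
Lemma conv_real : conv_dist_real (fun n : nat => c / n%:R)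
  (fun n s E => (#|@final_active K n s E|)%:R / n%:R) (\sum_(k < K) a 1 k).
Proof.
move=> g [M gM] gc.
pose F (h : R -> 'I_K -> R) := g (\sum_k h 1 k).
have one01 : 0 <= (1 : R) <= 1 by rewrite ler01 lexx.
have Fok : path_functional_ok F.
  split; first by exists M => h; exact: gM.
  move=> h e e0.
  have /cvgrPdist_lt /(_ e e0) := gc (\sum_k h 1 k).
  move=> [r /= r0 Hr]; exists (r / K.+1%:R); first by rewrite divr_gt0// ltr0n.
  move=> h' hh'; rewrite /F distrC; apply: Hr => /=.
  rewrite -sumrB; apply: le_lt_trans (ler_norm_sum _ _ _) _.
  apply: (@le_lt_trans _ _ (\sum_(k < K) r / K.+1%:R)).
    by apply: ler_sum => k _; rewrite distrC; exact: hh'.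
  rewrite sumr_const card_ord -[ltLHS]mulr_natl mulrCA -[ltRHS]mulr1 ltr_pM2l//.
  by rewrite ltr_pdivrMr ?ltr0n// mul1r ltr_nat.
have := conv_path Fok; rewrite /F.
rewrite (_ : (fun n => Exp _ (fun s E => g (\sum_k alpha_n s E 1 k))) =
  (fun n => Exp (c / n%:R) (fun s E => g (#|@final_active K n s E|%:R / n%:R)))) //.
apply/funext => n; congr Exp; apply/funext => s; apply/funext => E; congr g.
rewrite card_final_active// natr_sum mulr_suml; apply: eq_bigr => k _.
by rewrite /alpha_n Acount_cnt mulr1 natrK.
Qed.

End Limit.

Local Open Scope classical_set_scope.

Theorem theorem1 (R : realType) (c : R) (K : nat) (hc : 0 < c) (hK : (1 <= K)%N) :
  exists a : R -> 'I_K -> R,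
    is_solution c a /\
    (forall b : R -> 'I_K -> R, is_solution c b ->
       forall t, 0 <= t <= 1 -> b t = a t) /\
    conv_dist_path (fun n : nat => c / n%:R) (fun n s E => @alpha_n R K n s E) a /\
    conv_dist_real (fun n : nat => c / n%:R)
      (fun n s E => (#|@final_active K n s E|)%:R / n%:R)
      (\sum_(k < K) a 1 k).
Proof.
have [C [a [C0 dB dL alip aE]]] := clamped_solution_exists K c.
have sa : is_solution c a := clamped_is_solution hc hK C0 dL alip aE.
exists a; split => //; split; first by move=> b sb; exact: (solution_unique sa sb).
split; first exact: (conv_path hc hK C0 dL alip aE).
exact: (conv_real hc hK C0 dL alip aE).
Qed.
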